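(* Let $\lambda\in(-\sqrt2,\sqrt2)$. Then the only solution $f\in L_2(\mathbb{R}_+)$ of the integral equation $$\lambda f(x)+\sqrt{\frac2\pi}\int_0^\infty\left[\sin(xt)-\cos(xt)+\frac2\pi\sqrt{xt}\,S_{-1/2,1/2}(xt)\right]f(t)\,dt=0,\quad x>0,$$ is the trivial one $f=0$.
   Context: $\mathbb{R}_+=(0,\infty)$. The integral is understood in the mean square sense, i.e. as the $L_2(\mathbb{R}_+)$-limit of the integrals over $[1/N,N]$ as $N\to\infty$. Equalities between $L_2$ functions are understood almost everywhere. $S_{\mu,\nu}$ denotes the (second) Lommel function; for $\mu=-1/2$, $\nu=1/2$ it is the unique solution on $(0,\infty)$ of $z^2w''+zw'+(z^2-\nu^2)w=z^{\mu+1}$ with $w(z)\sim z^{\mu-1}$ as $z\to+\infty$. *)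

(* Defs.v *)
From mathcomp Require Import all_boot all_order all_algebra.
From mathcomp Require Import all_classical all_reals all_analysis.
From mathcomp Require Export complex.
Set Implicit Arguments.
Unset Strict Implicit.
Unset Printing Implicit Defensive.
Import Order.TTheory GRing.Theory Num.Theory.
Import numFieldNormedType.Exports.
Local Open Scope classical_set_scope.
Local Open Scope ring_scope.
Local Open Scope complex_scope.

Definition Rplus (R : realType) : set R := [set x | 0 < x].
Arguments Rplus : clear implicits.

(* Values of w outside ]0, +oo[ are irrelevant. *)
Definition is_lommelS (R : realType) (mu nu : R) (w : R -> R) : Prop :=
  [/\ forall z : R, 0 < z -> derivable w z 1,
      forall z : R, 0 < z -> derivable (derive1 w) z 1,
      forall z : R, 0 < z ->
        z ^+ 2 * derive1 (derive1 w) z + z * derive1 w z + (z ^+ 2 - nu ^+ 2) * w z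
          = z `^ (mu + 1)
    & w z / z `^ (mu - 1) @[z --> +oo] --> (1 : R)].

(* The second Lommel function S_{mu,nu}. The homogeneous (Bessel) solutions
   decay like z^{-1/2} while oscillating, so the asymptotics determines w
   uniquely on ]0, +oo[ when mu <= 1/2; only mu = -1/2, nu = 1/2 is used. *)
Definition lommelS (R : realType) (mu nu : R) : R -> R :=
  xget (fun=> 0) [set w | is_lommelS mu nu w].

Definition lommel_kernel (R : realType) (z : R) : R :=
  sin z - cos z
  + 2 / pi * Num.sqrt z * lommelS (- 2^-1) 2^-1 z.

(* Complex-valued L_2(R_+); f \_ A extends f by zero outside A. *)
Definition L2 (R : realType) (f : R -> R[i]) : Prop :=
  (fun x => complex.Re (f x)) \_ (Rplus R)
    \in Lfun (@lebesgue_measure R) 2%:E /\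
  (fun x => complex.Im (f x)) \_ (Rplus R)
    \in Lfun (@lebesgue_measure R) 2%:E.

Definition L2norm (R : realType) (f : R -> R[i]) : \bar R :=
  Lnorm (@lebesgue_measure R) 2%:E
    (EFin \o (fun x => complex.Re `|f x|) \_ (Rplus R)).

Definition Cintegral (R : realType) (A : set R) (f : R -> R[i]) : R[i] :=
  (\int[@lebesgue_measure R]_(x in A) complex.Re (f x)) +i*
  (\int[@lebesgue_measure R]_(x in A) complex.Im (f x)).

Definition mean_square_limit (R : realType)
    (h : nat -> R -> R[i]) (g : R -> R[i]) : Prop :=
  L2 g /\ L2norm (fun x => h N x - g x) @[N --> \oo] --> 0%E.

Definition truncated_transform (R : realType) (f : R -> R[i])
    (N : nat) (x : R) : R[i] :=
  Cintegral `[N%:R^-1, N%:R] (fun t => (lommel_kernel (x * t))%:C * f t).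

Definition solves_equation (R : realType) (lam : R) (f : R -> R[i]) : Prop :=
  exists g : R -> R[i],
    mean_square_limit (truncated_transform f) g /\
    {ae @lebesgue_measure R, forall x, 0 < x ->
       lam%:C * f x + (Num.sqrt (2 / pi))%:C * g x = 0}.

(* Main.v *)
Require Import Defs.
From mathcomp Require Import all_boot all_order all_algebra.
From mathcomp Require Import all_classical all_reals all_analysis.
From mathcomp Require Import measurable_realfun lebesgue_integral_under.
From mathcomp Require Import ring lra.
Set Implicit Arguments.
Unset Strict Implicit.
Unset Printing Implicit Defensive.
Import Order.TTheory GRing.Theory Num.Theory.
Import numFieldNormedType.Exports.
Local Open Scope ring_scope.

(** Write [K] for the kernel of the equation and [T] for the integral operator
    with kernel [K (x * t)]. On the half-line
      K z = sin z - cos z + 2 / pi * u z,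
      u z = int_0^oo exp (- z * r) / (1 + r^2) dr:
    the function [u] solves [u'' + u = 1 / z] with [z * u z --> 1], as
    [sqrt z * S z] does for the Lommel function [S], and two such functions
    differ by a combination of sine and cosine that tends to 0, hence agree
    ([lommel_kernelE]).

    The theorem holds because [T] expands: formally
      int_0^oo K (x * s) * K (x * t) dx = pi * delta (s - t) + 1 / (s + t),
    and the kernel [1 / (s + t)] is positive, being the Gram kernel
    int_0^oo exp (- y * s) * exp (- y * t) dy. Thus the squared norm of [T f] is
    at least [pi] times that of [f]. If [lam * f + sqrt (2 / pi) * T f = 0], then
    [lam^2] times the squared norm of [f] is [2 / pi] times that of [T f], so at
    least twice that of [f], and [lam^2 < 2] forces [f = 0]. The kernel is real,
    so the real and imaginary parts of [f] can be treated separately.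

    To give the formal identity a meaning, the variable [x] is weighted by
    [exp (- eps * x)]. The Gram kernel then becomes
      eps / (eps^2 + (s - t)^2) + 1 / (eps + s + t)
    up to an error that tends to 0 with [eps], uniformly for [s] and [t] away
    from 0 ([damped_gram_approx]). This rests on closed forms of the integrals of
    [sin * u], [cos * u] and [u * u], whose logarithmic terms cancel.
    The first summand is the Poisson kernel. Its form is positive, so it is
    bounded below by its linearization at a bounded truncation [g] of [f]
    ([poisson_form_ge]), and for bounded [g] it is an approximate identity at
    every Lebesgue point ([cvg_poisson_form]). The result is a lower bound for
    the energy of the transform of [f] over a compact window by [pi] times the
    energy of [g] on that window ([transform_energy_ge]). Letting the window and
    the truncation level grow, and comparing the transforms with their mean
    square limit, gives the inequality for [f] ([ae_eq0_of_limit]). *)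

(** * Derivatives *)

Section Derivatives.
Context {R : realType}.
Implicit Types (f g : R -> R) (x df dg : R).

Lemma der_cst x (c : R) : is_derive x 1 (fun=> c) 0.
Proof. exact: is_derive_cst. Qed.

Lemma der_id x : is_derive x 1 (fun y : R => y) 1.
Proof. exact: is_derive_id. Qed.

Lemma der_add f g x df dg : is_derive x 1 f df -> is_derive x 1 g dg ->
  is_derive x 1 (fun y => f y + g y) (df + dg).
Proof. exact: is_deriveD. Qed.

Lemma der_opp f x df : is_derive x 1 f df ->
  is_derive x 1 (fun y => - f y) (- df).
Proof. exact: is_deriveN. Qed.

Lemma der_mul f g x df dg : is_derive x 1 f df -> is_derive x 1 g dg ->
  is_derive x 1 (fun y => f y * g y) (f x * dg + g x * df).
Proof. exact: is_deriveM. Qed.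

Lemma der_exp2 f x df : is_derive x 1 f df ->
  is_derive x 1 (fun y => f y ^+ 2) (2 * f x * df).
Proof.
move=> fx; have -> : (fun y => f y ^+ 2) = (fun y => f y * f y).
  by apply/funext => y; rewrite expr2.
apply: (is_derive_eq (der_mul fx fx)).
by rewrite mulr_natl mulr2n mulrDl.
Qed.

Lemma der_inv f x df : f x != 0 -> is_derive x 1 f df ->
  is_derive x 1 (fun y => (f y)^-1) (- df / f x ^+ 2).
Proof.
move=> f0 fx; apply: (is_derive_eq (is_deriveV f0 fx)).
by rewrite /GRing.scale/= mulrC mulrN mulNr.
Qed.

Lemma der_comp f g x df dg : is_derive (g x) 1 f df -> is_derive x 1 g dg ->
  is_derive x 1 (fun y => f (g y)) (df * dg).
Proof. exact: is_derive1_comp. Qed.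

End Derivatives.

(* Resolution of [is_derive] as a type class commits to pointfree sums and
   products; [der] follows the syntax of the function instead and leaves the
   conditions of the quotients, logarithms and square roots. *)
Ltac der :=
  lazymatch goal with
  | |- is_derive _ _ (fun=> ?c) _ => exact (der_cst _ _)
  | |- is_derive _ _ (fun x => x) _ => exact (der_id _)
  | |- is_derive _ _ (fun x => _ + _) _ =>
      notypeclasses refine (der_add _ _); der
  | |- is_derive _ _ (fun x => - _) _ => notypeclasses refine (der_opp _); der
  | |- is_derive _ _ (fun x => _ ^+ 2) _ =>
      notypeclasses refine (der_exp2 _); der
  | |- is_derive _ _ (fun x => _ * _) _ =>
      notypeclasses refine (der_mul _ _); der
  | |- is_derive _ _ (fun x => (_)^-1) _ =>
      notypeclasses refine (der_inv _ _); [|der]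
  | |- is_derive _ _ (fun x => expR _) _ =>
      notypeclasses refine (der_comp (is_derive_expR _) _); der
  | |- is_derive _ _ (fun x => sin _) _ =>
      notypeclasses refine (der_comp (is_derive_sin _) _); der
  | |- is_derive _ _ (fun x => cos _) _ =>
      notypeclasses refine (der_comp (is_derive_cos _) _); der
  | |- is_derive _ _ (fun x => atan _) _ =>
      notypeclasses refine (der_comp (is_derive1_atan _) _); der
  | |- is_derive _ _ (fun x => ln _) _ =>
      notypeclasses refine (der_comp (is_derive1_ln _) _); [|der]
  | |- is_derive _ _ (fun x => Num.sqrt _) _ =>
      notypeclasses refine (der_comp (is_derive1_sqrt _) _); [|der]
  | |- is_derive _ _ (GRing.mul _) _ =>
      notypeclasses refine (der_mul (der_cst _ _) (der_id _))
  | |- is_derive _ _ (Algebra.add _) _ =>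
      notypeclasses refine (der_add (der_cst _ _) (der_id _))
  | |- is_derive _ _ -%R _ => notypeclasses refine (der_opp (der_id _))
  | |- is_derive _ _ expR _ => exact (is_derive_expR _)
  | |- is_derive _ _ sin _ => exact (is_derive_sin _)
  | |- is_derive _ _ cos _ => exact (is_derive_cos _)
  | |- is_derive _ _ atan _ => exact (is_derive1_atan _)
  | |- is_derive _ _ ln _ => notypeclasses refine (is_derive1_ln _)
  | |- is_derive _ _ Num.sqrt _ => notypeclasses refine (is_derive1_sqrt _)
  | |- is_derive _ _ _ _ => eassumption
  end.
Ltac deriv := notypeclasses refine (is_derive_eq _ _); [der | idtac]; cbv beta.

(** * Improper integrals on the half-line *)

Section ImproperIntegrals.
Context {R : realType}.
Local Open Scope classical_set_scope.
Local Notation mu := (@lebesgue_measure R).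
Implicit Types (f F : R -> R).

Definition Rp : set R := `]0, +oo[.

Lemma RpE (x : R) : Rp x = (0 < x) :> Prop.
Proof. by rewrite /Rp/= in_itv/= andbT. Qed.

Lemma measurable_Rp : measurable Rp.
Proof. exact: measurable_itv. Qed.
Hint Resolve measurable_Rp : core.

Lemma continuous_measurable f : {in Rp, continuous f} -> measurable_fun Rp f.
Proof.
by move=> cf; exact: open_continuous_measurable_fun.
Qed.

Lemma is_derive_continuous f (x df : R) : is_derive x 1 f df -> {for x, continuous f}.
Proof. by move=> [h _]; apply/differentiable_continuous/derivable1_diffP. Qed.

(** Stated as a constant so that it escapes type class resolution. *)
Definition primitive f F : Prop :=
  forall x : R, 0 <= x -> is_derive x 1 F (f x).

(** The derivative is also required at the end point 0, where every primitive
    met below is still smooth. *)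
Lemma ge0_FTC0y (f F : R -> R) (l : R) :
  (forall x : R, 0 <= x -> 0 <= f x) ->
  (forall x : R, 0 <= x -> {for x, continuous f}) ->
  primitive f F ->
  F x @[x --> +oo] --> l ->
  (\int[mu]_(x in Rp) (f x)%:E = (l - F 0)%:E)%E.
Proof.
move=> f0 cf dF Fl.
have mf : measurable_fun Rp f.
  by apply: continuous_measurable => x; rewrite inE RpE => /ltW; exact: cf.
rewrite /Rp integral_itv_obnd_cbnd; last exact/measurable_EFinP.
have dF' x : 0 < x -> derivable F x 1.
  by move=> x0; have [] := dF x (ltW x0).
have cF0 : {for 0, continuous F} by apply: is_derive_continuous; exact: dF.
rewrite EFinB; apply: (ge0_continuous_FTC2y (f := f)) => //.
- apply/continuous_within_itvcyP; split.
    by move=> x; rewrite in_itv/= andbT => /ltW; exact: cf.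
  by apply: cvg_at_right_filter; exact: cf.
- exact: cvg_at_right_filter.
- move=> x; rewrite in_itv/= andbT => x0.
  by rewrite derive1E; have [_] := dF x (ltW x0).
Qed.

Lemma ge0_integrable_Rp (f : R -> R) (l : R) :
  measurable_fun Rp f -> (forall x : R, 0 < x -> 0 <= f x) ->
  (\int[mu]_(x in Rp) (f x)%:E = l%:E)%E -> mu.-integrable Rp (EFin \o f).
Proof.
move=> mf f0 fl; apply/integrableP; split; first exact/measurable_EFinP.
under eq_integral => x.
  rewrite inE RpE => x0; rewrite /= ger0_norm ?f0//; over.
by rewrite fl ltry.
Qed.

Lemma cvgy_mull (p : R) : 0 < p -> p * x @[x --> +oo] --> +oo.
Proof.
move=> p0; apply: gt0_cvgMry => //; exact: cvg_id.
Qed.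

Lemma cvgy_expR (p : R) : 0 < p -> expR (- p * x) @[x --> +oo] --> (0 : R).
Proof.
move=> p0; under eq_fun do rewrite mulNr.
exact: (cvg_comp _ _ (cvgy_mull p0) (@cvgr_expR R)).
Qed.

Lemma cvgy_atan_mull (p : R) : 0 < p -> atan (p * x) @[x --> +oo] --> (pi / 2 : R).
Proof.
by move=> p0; exact: (cvg_comp _ _ (cvgy_mull p0) (@cvgy_atan R)).
Qed.

Lemma cvgy_invD (s : R) : (s + w)^-1 @[w --> +oo] --> (0 : R).
Proof.
apply/gtr0_cvgV0.
  near=> w; rewrite -ltrBlDl sub0r; near: w.
  by apply: nbhs_pinfty_gt; exact: num_real.
exact: cvg_addrl.
Unshelve. all: end_near. Qed.

Lemma int_expR (p : R) : 0 < p ->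
  (\int[mu]_(x in Rp) (expR (- p * x))%:E = (p^-1)%:E)%E.
Proof.
move=> p0.
rewrite (@ge0_FTC0y _ (fun x => - (p^-1 * expR (- p * x))) 0).
- by rewrite mulr0 expR0 mulr1 sub0r opprK.
- by move=> x _; exact: expR_ge0.
- move=> x x0; apply: is_derive_continuous; der.
- move=> x x0; deriv; field; lra.
- rewrite -oppr0 -(mulr0 p^-1); apply: cvgN; apply: cvgMl_tmp.
  exact: cvgy_expR.
Qed.

Lemma integrable_expR (p : R) : 0 < p ->
  mu.-integrable Rp (EFin \o (fun x => expR (- p * x))).
Proof.
move=> p0; apply: ge0_integrable_Rp (int_expR p0).
  apply: continuous_measurable => x _; apply: is_derive_continuous; der.
by move=> x _; exact: expR_ge0.
Qed.

Lemma cvgy_expR_bounded (p C : R) (g : R -> R) : 0 < p ->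
  (forall x, `|g x| <= C) -> expR (- p * x) * g x @[x --> +oo] --> (0 : R).
Proof.
move=> p0 gC; apply/norm_cvg0P.
apply: (@squeeze_cvgr _ _ _ _ (fun=> 0) (fun x => expR (- p * x) * C)).
- near=> x; rewrite normr_ge0/= normrM ger0_norm ?expR_ge0//.
  by rewrite ler_wpM2l ?expR_ge0.
- exact: cvg_cst.
- by rewrite -(mul0r C); apply: cvgMr_tmp; exact: cvgy_expR.
Unshelve. all: end_near. Qed.

(** Adding 1 to the oscillating factor makes the integrand nonnegative. *)
Lemma int_expR_cos (p h : R) : 0 < p ->
  \int[mu]_(x in Rp) (expR (- p * x) * cos (h * x)) = p / (p ^+ 2 + h ^+ 2).
Proof.
move=> p0.
have ph : p ^+ 2 + h ^+ 2 != 0 by nra.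
have cE : continuous (fun x => expR (- p * x) * (1 + cos (h * x))).
  by move=> x; apply: is_derive_continuous; der.
have E0 x : 0 <= expR (- p * x) * (1 + cos (h * x)).
  by rewrite mulr_ge0 ?expR_ge0//; have := cos_geN1 (h * x); lra.
have I1 : (\int[mu]_(x in Rp) (expR (- p * x) * (1 + cos (h * x)))%:E =
    (p^-1 + p / (p ^+ 2 + h ^+ 2))%:E)%E.
  rewrite (@ge0_FTC0y _ (fun x => expR (- p * x) * (- p^-1 +
    (- p * cos (h * x) + h * sin (h * x)) / (p ^+ 2 + h ^+ 2))) 0).
  - by rewrite !mulr0 expR0 cos0 sin0; congr EFin; field; lra.
  - by move=> x _; exact: E0.
  - by move=> x _; exact: cE.
  - move=> x x0; deriv; field; lra.
  - apply: (@cvgy_expR_bounded _ (p^-1 + (p + `|h|) / (p ^+ 2 + h ^+ 2))) => //.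
    move=> x; rewrite (le_trans (ler_normD _ _))// normrN ger0_norm ?invr_ge0 ?(ltW p0)//.
    rewrite lerD2l normrM normfV [X in _ / X]ger0_norm; last by nra.
    rewrite ler_pM2r ?invr_gt0; last by nra.
    rewrite (le_trans (ler_normD _ _))// !normrM normrN (ger0_norm (ltW p0)).
    by rewrite lerD// ler_piMr// ?cos_max ?sin_max// ltW.
have i1 : mu.-integrable Rp (EFin \o (fun x => expR (- p * x) * (1 + cos (h * x)))).
  apply: ge0_integrable_Rp I1 => //.
  by apply: continuous_measurable => x _; exact: cE.
transitivity (\int[mu]_(x in Rp) (expR (- p * x) * (1 + cos (h * x)) - expR (- p * x))).
  by apply: eq_Rintegral => x _; ring.
rewrite RintegralB //; last exact: integrable_expR.
by rewrite /Rintegral I1 int_expR//=; ring.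
Qed.

Lemma int_expR_sin (p h : R) : 0 < p ->
  \int[mu]_(x in Rp) (expR (- p * x) * sin (h * x)) = h / (p ^+ 2 + h ^+ 2).
Proof.
move=> p0.
have ph : p ^+ 2 + h ^+ 2 != 0 by nra.
have cE : continuous (fun x => expR (- p * x) * (1 + sin (h * x))).
  by move=> x; apply: is_derive_continuous; der.
have E0 x : 0 <= expR (- p * x) * (1 + sin (h * x)).
  by rewrite mulr_ge0 ?expR_ge0//; have := sin_geN1 (h * x); lra.
have I1 : (\int[mu]_(x in Rp) (expR (- p * x) * (1 + sin (h * x)))%:E =
    (p^-1 + h / (p ^+ 2 + h ^+ 2))%:E)%E.
  rewrite (@ge0_FTC0y _ (fun x => expR (- p * x) * (- p^-1 +
    (- p * sin (h * x) - h * cos (h * x)) / (p ^+ 2 + h ^+ 2))) 0).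
  - by rewrite !mulr0 expR0 cos0 sin0; congr EFin; field; lra.
  - by move=> x _; exact: E0.
  - by move=> x _; exact: cE.
  - move=> x x0; deriv; field; lra.
  - apply: (@cvgy_expR_bounded _ (p^-1 + (p + `|h|) / (p ^+ 2 + h ^+ 2))) => //.
    move=> x; rewrite (le_trans (ler_normD _ _))// normrN ger0_norm ?invr_ge0 ?(ltW p0)//.
    rewrite lerD2l normrM normfV [X in _ / X]ger0_norm; last by nra.
    rewrite ler_pM2r ?invr_gt0; last by nra.
    rewrite (le_trans (ler_normB _ _))// !normrM normrN (ger0_norm (ltW p0)).
    by rewrite lerD// ler_piMr// ?cos_max ?sin_max// ltW.
have i1 : mu.-integrable Rp (EFin \o (fun x => expR (- p * x) * (1 + sin (h * x)))).
  apply: ge0_integrable_Rp I1 => //.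
  by apply: continuous_measurable => x _; exact: cE.
transitivity (\int[mu]_(x in Rp) (expR (- p * x) * (1 + sin (h * x)) - expR (- p * x))).
  by apply: eq_Rintegral => x _; ring.
rewrite RintegralB //; last exact: integrable_expR.
by rewrite /Rintegral I1 int_expR//=; ring.
Qed.

Let cauchy_neq0 (r : R) : 1 + r ^+ 2 != 0.
Proof. by rewrite gt_eqF// ltr_wpDr// sqr_ge0. Qed.

Lemma int_cauchy : (\int[mu]_(r in Rp) ((1 + r ^+ 2)^-1)%:E = (pi / 2)%:E)%E.
Proof.
rewrite (@ge0_FTC0y _ (@atan R) (pi / 2)).
- by rewrite atan0 subr0.
- by move=> x _; rewrite invr_ge0; nra.
- by move=> x _; apply: is_derive_continuous; der; exact: cauchy_neq0.
- by move=> x _; exact: is_derive1_atan.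
- exact: cvgy_atan.
Qed.

Lemma integrable_cauchy :
  mu.-integrable Rp (EFin \o (fun r : R => (1 + r ^+ 2)^-1)).
Proof.
apply: ge0_integrable_Rp int_cauchy.
  by apply: continuous_measurable => x _; apply: is_derive_continuous; der; exact: cauchy_neq0.
by move=> x _; rewrite invr_ge0; nra.
Qed.

(** Partial fractions reduce this integrand to two Cauchy densities, and those of
    [int_cauchy_cos] and [int_stieltjes] to logarithmic derivatives; the poles
    must be distinct, whence [s != t]. *)
Lemma int_cauchy_sin (s t : R) : 0 < s -> 0 < t -> s != t ->
  (\int[mu]_(r in Rp) ((1 + r ^+ 2)^-1 * (s / ((t * r) ^+ 2 + s ^+ 2)))%:E =
  (pi / 2 / (s + t))%:E)%E.
Proof.
move=> s0 t0 st.
have d0 : s ^+ 2 - t ^+ 2 != 0 by rewrite subr_sqr mulf_neq0 ?subr_eq0// ; lra.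
have D1 x : (t * x) ^+ 2 + s ^+ 2 != 0 by nra.
have D2 x : 1 + x ^+ 2 != 0 :> R by nra.
rewrite (@ge0_FTC0y _ (fun r => s / (s ^+ 2 - t ^+ 2) *
  (atan r - (t / s) * atan ((t / s) * r))) (s / (s ^+ 2 - t ^+ 2) *
  (pi / 2 - (t / s) * (pi / 2)))).
- by rewrite mulr0 atan0; congr EFin; field; rewrite d0 /=; apply/andP; split; lra.
- by move=> x x0; rewrite mulr_ge0 ?invr_ge0// ?divr_ge0//; nra.
- by move=> x _; apply: is_derive_continuous; der.
- move=> x _; deriv; field; rewrite D1 D2 d0 /=; apply/andP; split; nra.
- apply: cvgMl_tmp; apply: cvgB; first exact: cvgy_atan.
  by apply: cvgMl_tmp; apply: cvgy_atan_mull; rewrite divr_gt0.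
Qed.

(** The inverse of the logarithmic mean of [s] and [t]; it is the common value,
    up to a factor, of the integrals of [cos * aux] and of [aux * aux]. *)
Definition logmean (s t : R) := (ln s - ln t) / (s - t).

Lemma int_cauchy_cos (s t : R) : 0 < s -> 0 < t -> s != t ->
  (\int[mu]_(r in Rp) ((1 + r ^+ 2)^-1 * ((t * r) / ((t * r) ^+ 2 + s ^+ 2)))%:E =
  (t / (s + t) * logmean s t)%:E)%E.
Proof.
move=> s0 t0 st.
have st0 : s - t != 0 by rewrite subr_eq0.
have D1 x : 0 < (t * x) ^+ 2 + s ^+ 2 by nra.
have D2 x : 0 < 1 + x ^+ 2 :> R by nra.
rewrite (@ge0_FTC0y _ (fun r => t / (2 * (s + t) * (s - t)) *
  - ln (((t * r) ^+ 2 + s ^+ 2) / (1 + r ^+ 2)))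
  (t / (2 * (s + t) * (s - t)) * - ln (t ^+ 2))).
- rewrite !mulr0 !expr0n/= add0r addr0 divr1 /logmean !expr2 !lnM ?posrE//.
  by congr EFin; field; rewrite st0 /=; lra.
- by move=> x x0; rewrite mulr_ge0 ?invr_ge0// ?divr_ge0//; nra.
- by move=> x _; apply: is_derive_continuous; der; rewrite gt_eqF.
- move=> x _; deriv.
  + by rewrite divr_gt0.
  + by rewrite gt_eqF.
  + by field; rewrite st0 !gt_eqF// addr_gt0.
- apply: cvgMl_tmp; apply: cvgN; apply: continuous_cvg.
    by apply: is_derive_continuous; apply: is_derive1_ln; nra.
  have -> : (fun r => ((t * r) ^+ 2 + s ^+ 2) / (1 + r ^+ 2)) =
     (fun r => t ^+ 2 + (s ^+ 2 - t ^+ 2) / (1 + r ^+ 2)).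
    by apply/funext => r; field; rewrite gt_eqF.
  rewrite -[X in _ --> X]addr0; apply: cvgD; first exact: cvg_cst.
  rewrite -(mulr0 (s ^+ 2 - t ^+ 2)); apply: cvgMl_tmp.
  apply/gtr0_cvgV0; first exact: nearW.
  apply: (@ger_cvgy _ _ _ _ (fun x => x)); last exact: cvg_id.
  by near=> x; nra.
Unshelve. all: end_near. Qed.

Lemma int_stieltjes (s t : R) : 0 < s -> 0 < t -> s != t ->
  (\int[mu]_(w in Rp) ((s + w)^-1 * (t + w)^-1)%:E = (logmean s t)%:E)%E.
Proof.
move=> s0 t0 st.
have st0 : s - t != 0 by rewrite subr_eq0.
have D w c : 0 < c -> 0 <= w -> 0 < c + w :> R by move=> *; lra.
apply: etrans; first apply: (@ge0_FTC0y _
    (fun w => ln ((t + w) / (s + w)) / (s - t)) 0).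
- by move=> w w0; rewrite mulr_ge0 ?invr_ge0// ltW// D.
- by move=> w w0; apply: is_derive_continuous; der; rewrite gt_eqF// D.
- move=> w w0; deriv.
  + by rewrite divr_gt0// D.
  + by rewrite gt_eqF// D.
  + by field; rewrite st0 !gt_eqF// D.
- rewrite -(mul0r (s - t)^-1); apply: cvgMr_tmp; rewrite -ln1.
  apply: continuous_cvg.
    by apply: is_derive_continuous; exact: is_derive1_ln.
  have : 1 + (t - s) / (s + w) @[w --> +oo] --> 1 + (t - s) * 0.
    apply: cvgD; first exact: cvg_cst.
    apply: cvgMl_tmp; exact: cvgy_invD.
  rewrite mulr0 addr0; apply: cvg_trans; apply: near_eq_cvg.
  near=> w; have w0 : 0 < s + w by apply: D.
  by field; rewrite gt_eqF.
- rewrite /= !addr0 /logmean ln_div ?posrE//.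
  by congr EFin; field.
Unshelve. all: end_near. Qed.

Lemma int_stieltjes_diag (s : R) : 0 < s ->
  (\int[mu]_(w in Rp) ((s + w)^-1 * (s + w)^-1)%:E = (s^-1)%:E)%E.
Proof.
move=> s0.
have D w : 0 <= w -> 0 < s + w by move=> *; lra.
apply: etrans; first apply: (@ge0_FTC0y _ (fun w => - (s + w)^-1) 0).
- by move=> w w0; rewrite mulr_ge0 ?invr_ge0// ltW// D.
- by move=> w w0; apply: is_derive_continuous; der; rewrite gt_eqF// D.
- by move=> w w0; deriv; rewrite ?gt_eqF ?D//; field; rewrite gt_eqF ?D.
- by rewrite -oppr0; apply: cvgN; exact: cvgy_invD.
- by rewrite /= addr0 sub0r opprK.
Qed.

Lemma int_poisson_diag (y : R) : 0 < y ->
  (\int[mu]_(x in Rp) (x / (x ^+ 2 + y ^+ 2) * (x / (x ^+ 2 + y ^+ 2)))%:E =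
  (pi / 2 / (y + y))%:E)%E.
Proof.
move=> y0.
have D x : 0 < x ^+ 2 + y ^+ 2 :> R by rewrite ltr_wpDl ?sqr_ge0 ?exprn_gt0.
apply: etrans; first apply: (@ge0_FTC0y _
    (fun x => (y^-1 * atan (y^-1 * x) - x / (x ^+ 2 + y ^+ 2)) / 2)
    ((y^-1 * (pi / 2) - 0) / 2)).
- by move=> x x0; rewrite mulr_ge0 ?divr_ge0// ltW// D.
- by move=> x _; apply: is_derive_continuous; der; rewrite gt_eqF// D.
- move=> x _; deriv; first by rewrite gt_eqF.
  by field; rewrite !gt_eqF ?D.
- apply: cvgMr_tmp; apply: cvgB.
    by apply: cvgMl_tmp; apply: cvgy_atan_mull; rewrite invr_gt0.
  apply: (@squeeze_cvgr _ _ _ _ (fun=> 0) (fun x => (0 + x)^-1)).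
  + near=> x; have x0 : 0 < x by near: x; apply: nbhs_pinfty_gt; exact: num_real.
    rewrite divr_ge0 ?(ltW x0) ?(ltW (D x))//= add0r ler_pdivrMr// ler_pdivlMl//.
    by rewrite -expr2 lerDl sqr_ge0.
  + exact: cvg_cst.
  + exact: cvgy_invD.
- by rewrite /= !mulr0 atan0 mul0r; congr EFin; field; lra.
Unshelve. all: end_near. Qed.

Lemma int_poisson (y z : R) : 0 < y -> 0 < z ->
  (\int[mu]_(x in Rp) (x / (x ^+ 2 + y ^+ 2) * (x / (x ^+ 2 + z ^+ 2)))%:E =
  (pi / 2 / (y + z))%:E)%E.
Proof.
move=> y0 z0; have [<-|yz] := eqVneq y z; first exact: int_poisson_diag.
have d0 : y - z != 0 by rewrite subr_eq0.
have D x a : 0 < a -> 0 < x ^+ 2 + a ^+ 2 :> R by nra.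
rewrite (@ge0_FTC0y _ (fun x => (y * atan (y^-1 * x) - z * atan (z^-1 * x)) /
   ((y + z) * (y - z))) ((y * (pi / 2) - z * (pi / 2)) / ((y + z) * (y - z)))).
- by rewrite !mulr0 atan0; congr EFin; field; rewrite d0 /=; lra.
- by move=> x x0; rewrite mulr_ge0 ?divr_ge0// ltW// D.
- by move=> x _; apply: is_derive_continuous; der; rewrite gt_eqF// D.
- by move=> x _; deriv; field; rewrite d0 !gt_eqF ?D// addr_gt0.
- apply: cvgMr_tmp; apply: cvgB; apply: cvgMl_tmp;
    by apply: cvgy_atan_mull; rewrite invr_gt0.
Qed.

End ImproperIntegrals.

#[global] Hint Extern 0 (@measurable _ _ (@Rp _)) => exact: measurable_Rp : core.

(** * Integrability and iterated integrals *)

Section Fubini.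
Context {R : realType}.
Local Open Scope classical_set_scope.
Local Notation mu := (@lebesgue_measure R).
Implicit Types (D E : set R) (a b f g : R -> R) (h : R * R -> R).

Lemma integrable_le_norm D (f g : R -> R) : measurable D ->
  measurable_fun D f -> (forall x, D x -> `|f x| <= g x) ->
  mu.-integrable D (EFin \o g) -> mu.-integrable D (EFin \o f).
Proof.
move=> mD mf fg; apply: le_integrable => //; first exact/measurable_EFinP.
by move=> x Dx; rewrite lee_fin (le_trans (fg x Dx))// ler_norm.
Qed.

Lemma integrable_scale D (k : R) f : measurable D ->
  mu.-integrable D (EFin \o f) -> mu.-integrable D (EFin \o (fun x => k * f x)).
Proof.
move=> mD fi; have := @integrableZl _ _ _ mu D mD k _ fi.
by congr (integrable _ _ _); apply/funext.
Qed.

Lemma integrable_add D f g : measurable D -> mu.-integrable D (EFin \o f) ->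
  mu.-integrable D (EFin \o g) ->
  mu.-integrable D (EFin \o (fun x => f x + g x)).
Proof.
move=> mD fi gi; have := @integrableD _ _ _ mu D mD _ _ fi gi.
by congr (integrable _ _ _); apply/funext.
Qed.

Lemma integrable_sub D f g : measurable D -> mu.-integrable D (EFin \o f) ->
  mu.-integrable D (EFin \o g) ->
  mu.-integrable D (EFin \o (fun x => f x - g x)).
Proof.
move=> mD fi gi; have := @integrableB _ _ _ mu D mD _ _ fi gi.
by congr (integrable _ _ _); apply/funext.
Qed.

(** The formula [x * exp (- ln (x ^+ 2))] expresses the inverse by measurable
    functions, including at 0, where both sides vanish. *)
Lemma measurable_inv : measurable_fun setT (@GRing.inv R).
Proof.
have -> : @GRing.inv R = (fun x => x * expR (- ln (x ^+ 2))).
  apply/funext => x; have [->|x0] := eqVneq x 0; first by rewrite invr0 mul0r.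
  have x2 : 0 < x ^+ 2 by rewrite exprn_even_gt0.
  by rewrite expRN lnK ?posrE//; field.
apply: measurable_funM => //; apply: measurableT_comp => //.
apply: measurableT_comp => //; apply: measurableT_comp => //.
Qed.

Lemma ae_imply (P Q : R -> Prop) : (forall x, P x -> Q x) ->
  {ae mu, forall x, P x} -> {ae mu, forall x, Q x}.
Proof. by move=> PQ; apply: negligibleS => x; apply: contra_not; exact: PQ. Qed.

Lemma ae_imply2 (P Q S : R -> Prop) : (forall x, P x -> Q x -> S x) ->
  {ae mu, forall x, P x} -> {ae mu, forall x, Q x} -> {ae mu, forall x, S x}.
Proof.
move=> PQS mP mQ; have := negligibleU mP mQ; apply: negligibleS => x nS.
by have [Px|] := pselect (P x); [right => Qx; exact/nS/PQS|left].
Qed.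

Lemma Rintegral0 D : \int[mu]_(x in D) (0 : R) = 0.
Proof. by rewrite /Rintegral integral0. Qed.

Lemma Rintegral_dominated_cvg D (F : nat -> R -> R) f g : measurable D ->
  (forall n, measurable_fun D (F n)) -> measurable_fun D f ->
  mu.-integrable D (EFin \o g) ->
  (forall n x, D x -> `|F n x| <= g x) ->
  {ae mu, forall x, D x -> F n x @[n --> \oo] --> f x} ->
  \int[mu]_(x in D) F n x @[n --> \oo] --> \int[mu]_(x in D) f x.
Proof.
move=> mD mF mf ig Fg Ff.
have := @dominated_convergence _ _ _ mu D mD
  (fun n => EFin \o F n) (EFin \o f) (EFin \o g).
case.
- by move=> n; apply/measurable_EFinP; exact: mF.
- exact/measurable_EFinP.
- apply: ae_imply Ff => x Ffx Dx; apply: cvg_EFin; first exact: nearW.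
  exact: Ffx.
- exact: ig.
- by apply: aeW => x n Dx; rewrite lee_fin; exact: Fg.
move=> fi _ cF; apply: fine_cvg.
rewrite fineK; first exact: cF.
exact: integrable_fin_num.
Qed.

(** Cutting the integrand off outside [D `*` E] reduces the exchange to integrals
    over the whole plane. *)
Lemma tonelli_on D E h : measurable D -> measurable E ->
  measurable_fun setT h -> (forall x y, D x -> E y -> 0 <= h (x, y)) ->
  (\int[mu]_(x in D) \int[mu]_(y in E) (h (x, y))%:E =
   \int[mu]_(y in E) \int[mu]_(x in D) (h (x, y))%:E)%E.
Proof.
move=> mD mE mh h0.
have mDE : measurable (D `*` E) by exact: measurableX.
pose H (z : R * R) := ((h \_ (D `*` E)) z)%:E.
have H0 z : (0 <= H z)%E.
  rewrite /H lee_fin patchE; case: ifPn => //; rewrite inE => -[].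
  by case: z => x y /=; exact: h0.
have mH : measurable_fun setT H.
  apply/measurable_EFinP; apply/(measurable_restrictT _ _).1 => //.
  exact: measurable_funTS.
have HE x y : H (x, y) = (if (x \in D) && (y \in E) then h (x, y) else 0)%:E.
  by rewrite /H patchE in_setX.
transitivity (\int[mu]_x \int[mu]_y H (x, y))%E.
  rewrite integral_mkcond; apply: eq_integral => x _; rewrite patchE.
  case: ifPn => xD; last by rewrite integral0_eq// => y _; rewrite HE (negbTE xD).
  rewrite integral_mkcond; apply: eq_integral => y _.
  by rewrite HE patchE xD /=; case: ifPn.
rewrite (fubini_tonelli (m1 := mu) (m2 := mu) H mH H0) [RHS]integral_mkcond.
apply: eq_integral => y _; rewrite patchE; case: ifPn => yE; last first.
  by rewrite integral0_eq// => x _; rewrite HE (negbTE yE) andbF.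
rewrite [RHS]integral_mkcond; apply: eq_integral => x _.
by rewrite HE patchE yE andbT; case: ifPn.
Qed.

Lemma measurable_tonelli_on D E h : measurable D -> measurable E ->
  measurable_fun setT h -> (forall x y, D x -> E y -> 0 <= h (x, y)) ->
  measurable_fun D (fun x => \int[mu]_(y in E) (h (x, y))%:E)%E.
Proof.
move=> mD mE mh h0.
pose H (z : R * R) := ((h \_ (D `*` E)) z)%:E.
have H0 z : (0 <= H z)%E.
  rewrite /H lee_fin patchE; case: ifPn => //; rewrite inE => -[].
  by case: z => x y /=; exact: h0.
have mH : measurable_fun setT H.
  apply/measurable_EFinP; apply/(measurable_restrictT _ _).1.
    exact: measurableX.
  exact: measurable_funTS.
have mF := measurable_fun_fubini_tonelli_F (m2 := mu) H mH H0.
apply: (eq_measurable_fun (fubini_F mu H)); last exact: measurable_funTS.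
move=> x xD; rewrite /fubini_F [RHS]integral_mkcond; apply: eq_integral => y _.
by rewrite /H !patchE in_setX xD /=; case: ifPn.
Qed.

Lemma measurable_Rintegral E h : measurable E -> measurable_fun setT h ->
  measurable_fun setT (fun x => \int[mu]_(y in E) h (x, y)).
Proof.
move=> mE mh; apply: measurableT_comp => //.
have mH : measurable_fun setT (fun z : R * R => (h z)%:E) by exact/measurable_EFinP.
have m0 (k : R * R -> \bar R) : measurable_fun setT k -> (forall z, 0 <= k z)%E ->
    measurable_fun setT (fun x => \int[mu]_(y in E) k (x, y))%E.
  move=> mk k0; pose K (z : R * R) : \bar R := (k \_ (setT `*` E)) z.
  have -> : (fun x => \int[mu]_(y in E) k (x, y))%E = fubini_F mu K.
    apply/funext => x; rewrite /fubini_F [LHS]integral_mkcond; apply: eq_integral => y _.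
    by rewrite /K !patchE in_setX in_setT.
  apply: measurable_fun_fubini_tonelli_F.
    apply/(measurable_restrictT _ _).1; first exact: measurableX.
    exact: measurable_funTS.
  by move=> z; rewrite /K patchE; case: ifPn.
rewrite (_ : (fun x => _) = fun x => (\int[mu]_(y in E) ((fun z => (h z)%:E)^\+ (x, y)) -
    \int[mu]_(y in E) ((fun z => (h z)%:E)^\- (x, y)))%E); last first.
  apply/funext => x; rewrite integralE; congr (_ - _)%E;
    by apply: eq_integral => y _; rewrite ?funeposE ?funenegE.
by apply: emeasurable_funB; apply: m0 => //;
  [exact: measurable_funepos|exact: measurable_funeneg].
Qed.

Lemma measurable_section h x :
  measurable_fun setT h -> measurable_fun setT (fun y => h (x, y)).
Proof. by move=> mh; exact: (measurableT_comp mh (measurable_pair1 x)). Qed.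

Section dominated.
Variables (D E : set R) (a b : R -> R) (h : R * R -> R).
Hypotheses (mD : measurable D) (mE : measurable E).
Hypotheses (ia : mu.-integrable D (EFin \o a)) (ib : mu.-integrable E (EFin \o b)).
Hypothesis mh : measurable_fun setT h.
Hypothesis hab : forall x y, D x -> E y -> `|h (x, y)| <= a x * b y.

Let H (z : R * R) := ((h \_ (D `*` E)) z)%:E.

Let mH : measurable_fun setT H.
Proof.
apply/measurable_EFinP; apply/(measurable_restrictT _ _).1 => //.
  exact: measurableX.
exact: measurable_funTS.
Qed.

Let HE x y : H (x, y) = (if (x \in D) && (y \in E) then h (x, y) else 0)%:E.
Proof. by rewrite /H patchE in_setX. Qed.

Let iH : (mu \x mu)%E.-integrable setT H.
Proof.
apply/(integrable12ltyP mu mu mH).2.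
pose A := EFin \o (a \_ D); pose B := EFin \o (b \_ E).
have iA : mu.-integrable setT A by rewrite /A -restrict_EFin -integrable_mkcond.
have iB : mu.-integrable setT B by rewrite /B -restrict_EFin -integrable_mkcond.
have AB x : (\int[mu]_y (`|A x| * `|B y|) = `|A x| * \int[mu]_y `|B y|)%E.
  rewrite ge0_integralZl//; apply: measurableT_comp => //.
  exact: (measurable_int mu iB).
apply: (@le_lt_trans _ _ (\int[mu]_x \int[mu]_y (`|A x| * `|B y|))%E).
  have [mA mB] := (measurable_int mu iA, measurable_int mu iB).
  apply: ge0_le_integral => //.
  - by move=> x _; exact: integral_ge0.
  - apply: (measurable_fun_fubini_tonelli_F (m2 := mu) (abse \o H)) => //=.
    exact: measurableT_comp.
  - rewrite (_ : (fun x => _) = (fun x => `|A x| * \int[mu]_y `|B y|)%E); last first.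
      by apply/funext => x; exact: AB.
    apply: emeasurable_funM; last exact: measurable_cst.
    exact: measurableT_comp.
  - move=> x _; apply: ge0_le_integral => //.
    + apply: measurableT_comp => //.
      exact: (measurableT_comp mH (measurable_pair1 x)).
    + by apply: emeasurable_funM; [exact: measurable_cst|exact: measurableT_comp].
    + move=> y _; rewrite HE /A /B /= !patchE.
      case: (boolP (x \in D)) => xD; case: (boolP (y \in E)) => yE /=;
        try by rewrite normr0 -EFinM lee_fin mulr_ge0.
      rewrite -EFinM lee_fin -normrM (le_trans (hab (set_mem xD) (set_mem yE)))//.
      exact: ler_norm.
under eq_integral do rewrite AB.
have /integrableP[mA ltA] := iA; have /integrableP[mB ltB] := iB.
rewrite ge0_integralZr//; [|exact: measurableT_comp|exact: integral_ge0].
by rewrite lte_mul_pinfty// ?integral_ge0// ge0_fin_numE// integral_ge0.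
Qed.

Lemma integrable_section x : D x -> mu.-integrable E (fun y => (h (x, y))%:E).
Proof.
move=> Dx.
apply: (@integrable_le_norm E (fun y => h (x, y)) (fun y => a x * b y)) => //.
- by apply: measurable_funTS; exact: measurable_section.
- by move=> y Ey; exact: hab.
- exact: integrable_scale.
Qed.

Let F1 x : fubini_F mu H x = ((fun x => (\int[mu]_(y in E) h (x, y))%:E) \_ D) x.
Proof.
rewrite /fubini_F patchE; case: ifPn => xD.
  rewrite /Rintegral fineK; last first.
    by apply: integrable_fin_num => //; exact/integrable_section/set_mem.
  rewrite [RHS]integral_mkcond; apply: eq_integral => y _.
  by rewrite HE patchE xD /=; case: ifPn.
by rewrite integral0_eq// => y _; rewrite HE (negbTE xD).
Qed.

Lemma integrable_Rintegral :
  mu.-integrable D (fun x => (\int[mu]_(y in E) h (x, y))%:E).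
Proof.
rewrite integrable_mkcond//.
have := integrable_fubini_F iH.
by congr (integrable _ _ _); apply/funext => x; exact: F1.
Qed.

Lemma Rintegral_iterated :
  (\int[mu]_(x in D) \int[mu]_(y in E) h (x, y))%:E =
  (\int[mu]_x \int[mu]_y H (x, y))%E.
Proof.
rewrite {1}/Rintegral fineK; last first.
  by apply: integrable_fin_num => //; exact: integrable_Rintegral.
rewrite integral_mkcond; apply: eq_integral => x _.
by rewrite -F1.
Qed.

Lemma Fubini_iterated :
  (\int[mu]_x \int[mu]_y H (x, y) = \int[mu]_y \int[mu]_x H (x, y))%E.
Proof. exact: (Fubini iH). Qed.

End dominated.

Lemma Rintegral_swap D E a b h : measurable D -> measurable E ->
  mu.-integrable D (EFin \o a) -> mu.-integrable E (EFin \o b) ->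
  measurable_fun setT h ->
  (forall x y, D x -> E y -> `|h (x, y)| <= a x * b y) ->
  \int[mu]_(x in D) \int[mu]_(y in E) h (x, y) =
  \int[mu]_(y in E) \int[mu]_(x in D) h (x, y).
Proof.
move=> mD mE ia ib mh hab.
apply/EFin_inj; rewrite (Rintegral_iterated mD mE ia ib mh hab).
rewrite (Fubini_iterated mD mE ia ib mh hab).
have mh' : measurable_fun setT (h \o (fun z => (z.2, z.1))).
  by apply: measurableT_comp => //; exact: measurable_swap.
have hba y x : E y -> D x -> `|(h \o (fun z => (z.2, z.1))) (y, x)| <= b y * a x.
  by move=> Ey Dx; rewrite mulrC; exact: hab.
have := Rintegral_iterated mE mD ib ia mh' hba; rewrite /= => ->.
apply: eq_integral => y _; apply: eq_integral => x _.
by rewrite !patchE !in_setX andbC.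
Qed.

End Fubini.

(** * The Laplace transform of the Cauchy density *)

Section AuxiliaryFunction.
Context {R : realType}.
Local Open Scope classical_set_scope.
Local Notation mu := (@lebesgue_measure R).
Local Notation Rp := (@Rp R).

Definition lap (k : nat) (z r : R) : R := r ^+ k * (1 + r ^+ 2)^-1 * expR (- z * r).

(** [aux 0] and [aux 1] are the auxiliary functions of the sine and cosine
    integrals. *)
Definition aux (k : nat) (z : R) : R := \int[mu]_(r in Rp) lap k z r.

Lemma measurable_lap k : measurable_fun setT (fun zr : R * R => lap k zr.1 zr.2).
Proof.
have m2 : measurable_fun setT (snd : R * R -> R) by exact: measurable_snd.
have mV : measurable_fun setT (fun r : R => (1 + r ^+ 2)^-1).
  apply: continuous_measurable_fun => r; apply: is_derive_continuous.
  by der; rewrite gt_eqF// ltr_wpDr// sqr_ge0.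
apply: measurable_funM.
  apply: measurable_funM; first exact: measurable_funX.
  exact: (measurableT_comp mV m2).
apply: measurableT_comp => //; apply: measurable_funM => //.
by apply: measurableT_comp => //; exact: measurable_fst.
Qed.

Lemma measurable_lap1 k z : measurable_fun setT (lap k z).
Proof. exact: (@measurable_section R _ z (measurable_lap k)). Qed.

Lemma lap_ge0 k z r : 0 <= r -> 0 <= lap k z r.
Proof.
by move=> r0; rewrite !mulr_ge0 ?exprn_ge0 ?expR_ge0// invr_ge0 addr_ge0// sqr_ge0.
Qed.

Lemma lap0_le z r : 0 <= z -> 0 <= r -> lap 0 z r <= (1 + r ^+ 2)^-1.
Proof.
move=> z0 r0; rewrite /lap expr0 mul1r ler_piMr//.
  by rewrite invr_ge0 addr_ge0// sqr_ge0.
by rewrite -expR0 ler_expR mulNr oppr_le0 mulr_ge0.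
Qed.

Lemma lap_le k z r : (k <= 2)%N -> 0 <= r -> lap k z r <= expR (- z * r).
Proof.
move=> k2 r0; rewrite /lap ler_piMl ?expR_ge0// ler_pdivrMr; last first.
  by rewrite ltr_wpDr// sqr_ge0.
case: k k2 => [|[|[|//]]] _; rewrite ?expr0 ?expr1; nra.
Qed.

Lemma integrable_lap0 z : 0 <= z -> mu.-integrable Rp (EFin \o lap 0 z).
Proof.
move=> z0; apply: (@integrable_le_norm R Rp (lap 0 z) (fun r => (1 + r ^+ 2)^-1)).
- exact: measurable_Rp.
- by apply: measurable_funTS; exact: measurable_lap1.
- by move=> r; rewrite RpE => /ltW r0; rewrite ger0_norm ?lap_ge0// lap0_le.
- exact: integrable_cauchy.
Qed.

Lemma integrable_lap k z : (k <= 2)%N -> 0 < z -> mu.-integrable Rp (EFin \o lap k z).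
Proof.
move=> k2 z0; apply: (@integrable_le_norm R Rp (lap k z) (fun r => expR (- z * r))).
- exact: measurable_Rp.
- by apply: measurable_funTS; exact: measurable_lap1.
- by move=> r; rewrite RpE => /ltW r0; rewrite ger0_norm ?lap_ge0// lap_le.
- exact: integrable_expR.
Qed.

Lemma aux_ge0 k z : 0 <= aux k z.
Proof. by apply: Rintegral_ge0 => r; rewrite RpE => /ltW; exact: lap_ge0. Qed.

Lemma aux0_le z : 0 <= z -> aux 0 z <= pi / 2.
Proof.
move=> z0; have -> : pi / 2 = \int[mu]_(r in Rp) (1 + r ^+ 2)^-1.
  by rewrite /Rintegral int_cauchy.
apply: le_Rintegral => //; [exact: integrable_lap0|exact: integrable_cauchy|].
by move=> r; rewrite RpE => /ltW; exact: lap0_le.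
Qed.

Lemma aux0_norm_le z : 0 <= z -> `|aux 0 z| <= pi / 2.
Proof. by move=> z0; rewrite ger0_norm ?aux_ge0// aux0_le. Qed.

Lemma aux0_nonincreasing y z : 0 <= y -> y <= z -> aux 0 z <= aux 0 y.
Proof.
move=> y0 yz; apply: le_Rintegral => //; first exact: integrable_lap0 (le_trans y0 yz).
  exact: integrable_lap0.
move=> r; rewrite RpE => r0; rewrite /lap ler_wpM2l//.
  by rewrite mulr_ge0// invr_ge0 addr_ge0// sqr_ge0.
by rewrite ler_expR !mulNr lerN2 ler_wpM2r// ltW.
Qed.

Lemma measurable_aux k : measurable_fun setT (aux k).
Proof.
apply: measurableT_comp => //.
pose H (zr : R * R) : \bar R := ((fun zr => lap k zr.1 zr.2) \_ (setT `*` Rp) zr)%:E.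
have -> : (fun z => \int[mu]_(r in Rp) (lap k z r)%:E)%E =
    (fun z => \int[mu]_r H (z, r))%E.
  apply/funext => z; rewrite integral_mkcond; apply: eq_integral => r _.
  by rewrite /H !patchE in_setX in_setT /=; case: ifPn.
apply: (measurable_fun_fubini_tonelli_F (m2 := mu) H).
  apply/measurable_EFinP; apply/(measurable_restrictT _ _).1.
    by apply: measurableX => //; exact: measurable_Rp.
  by apply: measurable_funTS; exact: measurable_lap.
move=> [z r]; rewrite /H lee_fin patchE; case: ifPn => //=.
by rewrite in_setX => /andP[_]; rewrite inE RpE => /ltW; exact: lap_ge0.
Qed.

(** Differentiation under the integral sign; near [z] the derivatives are
    dominated by [expR (- (z / 2) * r)]. *)
Lemma is_derive_aux k (z : R) : (k <= 1)%N -> 0 < z ->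
  is_derive z 1 (aux k) (- aux k.+1 z).
Proof.
move=> k1 z0.
have der_lap (y r : R) : is_derive y 1 (fun y => lap k y r) (- lap k.+1 y r).
  by rewrite /lap; deriv; rewrite (exprS r k); set c := r ^+ k; set d := _^-1; ring.
pose u := z / 2; pose v := z + 1.
have Iz : `]u, v[%classic z by rewrite /u /v /= in_itv/=; apply/andP; split; lra.
have intf x : `]u, v[%classic x -> mu.-integrable Rp (EFin \o lap k x).
  rewrite /= in_itv/= => /andP[ux _]; apply: integrable_lap.
    exact: leq_trans k1 _.
  by rewrite (lt_trans _ ux)// /u; lra.
have df x r : `]u, v[%classic x -> Rp r -> derivable (lap k ^~ r) x 1.
  by move=> _ _; have [] := der_lap x r.
have G0 r : 0 <= expR (- u * r) by exact: expR_ge0.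
have u0 : 0 < u by rewrite /u; lra.
have GE x r : `]u, v[%classic x -> Rp r ->
    `|partial1of2 (lap k) x r| <= expR (- u * r).
  rewrite /= in_itv/= RpE => /andP[ux _] r0; rewrite partial1of2E.
  have [_ ->] := der_lap x r; rewrite normrN ger0_norm ?lap_ge0// ?(ltW r0)//.
  rewrite (le_trans (lap_le _ _ _))// ?(ltW r0)//.
  by rewrite ler_expR !mulNr lerN2 ler_wpM2r// ltW.
have mR := @measurable_Rp R.
apply: DeriveDef.
  by have := derivable_under_integral (mu := mu) mR Iz intf df G0 (integrable_expR u0) GE.
rewrite -derive1E.
rewrite (differentiation_under_integral (mu := mu) mR Iz intf df G0 (integrable_expR u0) GE).
have -> : \int[mu]_(y in Rp) (partial1of2 (lap k))^~ y z =
    \int[mu]_(r in Rp) (-1 * lap k.+1 z r).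
  apply: eq_Rintegral => r _; rewrite partial1of2E.
  by have [_ ->] := der_lap z r; rewrite mulN1r.
by rewrite RintegralZl ?mulN1r//; exact: integrable_lap.
Qed.

(** The factors [1] and [r ^+ 2] add up to the denominator [1 + r ^+ 2], which
    leaves the Laplace transform of 1. *)
Lemma aux_ode z : 0 < z -> aux 0 z + aux 2 z = z^-1.
Proof.
move=> z0; rewrite /aux -RintegralD//; [|exact: integrable_lap..].
rewrite /Rintegral -[RHS]/(fine (z^-1)%:E) -(int_expR z0); congr fine.
apply: eq_integral => r _; congr EFin; rewrite /lap; field.
by rewrite gt_eqF// ltr_wpDr// sqr_ge0.
Qed.

Lemma aux2_le z : 0 < z -> aux 2 z <= 2 / z ^+ 2.
Proof.
move=> z0.
have z2 : 0 < z / 2 by lra.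
have -> : 2 / z ^+ 2 = \int[mu]_(r in Rp) (z^-1 * expR (- (z / 2) * r)).
  rewrite RintegralZl//; last exact: integrable_expR.
  rewrite /Rintegral int_expR//=; field; lra.
apply: le_Rintegral => //.
- exact: integrable_lap.
- by apply: integrable_scale => //; exact: integrable_expR.
move=> r; rewrite RpE => r0; rewrite /lap.
have -> : - z * r = - (z / 2) * r + - (z / 2) * r by lra.
rewrite expRD mulrA ler_wpM2r ?expR_ge0//.
have h1 : r ^+ 2 / (1 + r ^+ 2) <= r / 2.
  rewrite ler_pdivrMr ?ltr_wpDr ?sqr_ge0//.
  have := sqr_ge0 (r - 1); nra.
have h2 : r / 2 * expR (- (z / 2) * r) <= z^-1.
  rewrite mulNr expRN ler_pdivrMr ?expR_gt0// ler_pdivlMl//.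
  by apply: le_trans (expR_ge1Dx _); nra.
by apply: le_trans h2; rewrite ler_wpM2r ?expR_ge0.
Qed.

(** By the differential equation, [z * aux 0 z] differs from 1 by [z * aux 2 z]. *)
Lemma aux0_asymptotics : z * aux 0 z @[z --> +oo] --> (1 : R).
Proof.
apply/subr_cvg0.
apply: norm_cvg0.
apply: (@squeeze_cvgr _ _ _ _ (fun=> 0) (fun z => 2 * z^-1)).
- near=> z; have z0 : 0 < z by near: z; exact: nbhs_pinfty_gt.
  rewrite normr_ge0/=.
  have -> : z * aux 0 z - 1 = - (z * aux 2 z).
    have -> : aux 0 z = z^-1 - aux 2 z by rewrite -(aux_ode z0); ring.
    by field; lra.
  rewrite normrN ger0_norm; last by rewrite mulr_ge0 ?aux_ge0// ltW.
  rewrite (@le_trans _ _ (z * (2 / z ^+ 2)))//.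
    by rewrite ler_wpM2l ?(ltW z0)// aux2_le.
  by rewrite le_eqVlt; apply/orP; left; apply/eqP; field; lra.
- exact: cvg_cst.
- rewrite -(mulr0 2); apply: cvgMl_tmp.
  by have := @cvgy_invD R 0; under eq_fun do rewrite add0r.
Unshelve. all: end_near. Qed.

Lemma continuous_poisson_laplace (x s : R) : 0 < x ->
  continuous (fun y : R => x / (x ^+ 2 + y ^+ 2) * expR (- s * y)).
Proof.
move=> x0 y; apply: is_derive_continuous; der.
by rewrite gt_eqF// ltr_wpDr ?sqr_ge0 ?exprn_gt0.
Qed.

(** The substitution [y = x * r]. In this form [x] enters only through the
    conjugate Poisson kernel, so products of values of [aux 0] can be integrated
    in [x] first. *)
Lemma aux0_poisson x s : 0 < x -> 0 < s ->
  ((aux 0 (x * s))%:E =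
   \int[mu]_(y in Rp) (x / (x ^+ 2 + y ^+ 2) * expR (- s * y))%:E)%E.
Proof.
move=> x0 s0; pose G y := x / (x ^+ 2 + y ^+ 2) * expR (- s * y).
have cG : continuous G by exact: continuous_poisson_laplace.
have dF : (fun r => x * r)^`() = (fun=> x).
  apply/funext => r; rewrite derive1E.
  by have [_ ->] := der_mul (der_cst r x) (der_id r); rewrite /= mulr1 mulr0 addr0.
have := @increasing_ge0_integration_by_substitutiony R (fun r => x * r) G 0.
rewrite dF mulr0 => H.
rewrite /Rp integral_itv_obnd_cbnd; last first.
  by apply/measurable_EFinP; apply: measurable_funTS; exact: continuous_measurable_fun.
rewrite -/(G _) H; first last.
- move=> y; rewrite in_itv/= andbT => /ltW y0; rewrite /G mulr_ge0 ?expR_ge0//.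
  by rewrite divr_ge0 ?(ltW x0)// addr_ge0 ?sqr_ge0.
- exact: continuous_subspaceT.
- exact: cvgy_mull.
- split.
    move=> r _; have [] := der_mul (der_cst r x) (der_id r) => //.
  apply: cvg_at_right_filter; apply: (is_derive_continuous (df := x * 1 + 0 * 0)).
  exact: (der_mul (der_cst _ _) (der_id _)).
- exact: is_cvg_cst.
- exact: is_cvg_cst.
- by move=> r _; exact: cvg_cst.
- by move=> y z _ _; rewrite ltr_pM2l.
rewrite /aux /Rintegral fineK; last first.
  apply: integrable_fin_num => //; apply: integrable_lap0.
  by rewrite ltW// mulr_gt0.
rewrite /Rp integral_itv_obnd_cbnd; last first.
  by apply/measurable_EFinP; apply: measurable_funTS; exact: measurable_lap1.
apply: eq_integral => r _; congr EFin.
rewrite /lap /G fctE /= expr0 mul1r mulrAC; congr (_ * _).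
  by field; rewrite !gt_eqF// ?ltr_wpDr ?sqr_ge0 ?exprn_gt0.
by congr expR; ring.
Qed.

Lemma measurable_poisson_laplace s :
  measurable_fun setT (fun z : R * R =>
    z.1 / (z.1 ^+ 2 + z.2 ^+ 2) * expR (- s * z.2)).
Proof.
have m1 : measurable_fun setT (fst : R * R -> R) by exact: measurable_fst.
have m2 : measurable_fun setT (snd : R * R -> R) by exact: measurable_snd.
have mV : measurable_fun setT (@GRing.inv R) by exact: measurable_inv.
apply: measurable_funM; last first.
  by apply: measurableT_comp => //; exact: measurable_funM.
apply: measurable_funM => //; apply: (measurableT_comp mV).
by apply: measurable_funD; exact: measurable_funX.
Qed.

(** Both sides are the integral of [exp (- (s + w) * y) * exp (- (t + w) * z)]
    over positive [w], [y] and [z]. *)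
Lemma int_stieltjesE (s t : R) : 0 < s -> 0 < t ->
  (\int[mu]_(w in Rp) ((s + w)^-1 * (t + w)^-1)%:E =
   \int[mu]_(y in Rp) \int[mu]_(z in Rp)
     ((y + z)^-1 * expR (- s * y) * expR (- t * z))%:E)%E.
Proof.
move=> s0 t0.
have D c w : 0 < c -> 0 < w -> 0 < c + w :> R by move=> *; lra.
have m1 : measurable_fun setT (fst : R * R -> R) by exact: measurable_fst.
have m2 : measurable_fun setT (snd : R * R -> R) by exact: measurable_snd.
have mE (a b : R * R -> R) : measurable_fun setT a -> measurable_fun setT b ->
    measurable_fun setT (fun p => expR (- a p * b p)).
  move=> ma mb; apply: measurableT_comp => //; apply: measurable_funM => //.
  exact: measurableT_comp.
have mI (c : R) : measurable_fun setT (fun p : R * R => (c + p.2)^-1).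
  by apply: (measurableT_comp measurable_inv); exact: measurable_funD.
transitivity (\int[mu]_(y in Rp) \int[mu]_(w in Rp)
    ((t + w)^-1 * expR (- (s + w) * y))%:E)%E.
  rewrite (tonelli_on (h := fun p => (t + p.2)^-1 * expR (- (s + p.2) * p.1)))//; first last.
  - by move=> y w; rewrite !RpE => y0 w0; rewrite mulr_ge0 ?expR_ge0// invr_ge0 ltW ?D.
  - by apply: measurable_funM => //; apply: mE => //; exact: measurable_funD.
  apply: eq_integral => w; rewrite inE RpE => w0.
  under [RHS]eq_integral do rewrite /= EFinM.
  rewrite ge0_integralZl//.
  - by rewrite int_expR ?D// -EFinM mulrC.
  - apply/measurable_EFinP; apply: measurable_funTS.
    exact: (measurable_section (s + w) (mE _ _ m1 m2)).
  - by rewrite lee_fin invr_ge0 ltW ?D.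
apply: eq_integral => y; rewrite inE RpE => y0.
transitivity (\int[mu]_(z in Rp) \int[mu]_(w in Rp)
    (expR (- (s + w) * y) * expR (- (t + w) * z))%:E)%E.
  rewrite (tonelli_on (h := fun p => expR (- (s + p.2) * y) * expR (- (t + p.2) * p.1)))//; first last.
  - apply: measurable_funM; apply: mE => //; exact: measurable_funD.
  - apply: eq_integral => w; rewrite inE RpE => w0.
    under [RHS]eq_integral do rewrite /= EFinM.
    rewrite ge0_integralZl//.
    + by rewrite int_expR ?D// -EFinM mulrC.
    + apply/measurable_EFinP; apply: measurable_funTS.
      exact: (measurable_section (t + w) (mE _ _ m1 m2)).
apply: eq_integral => z; rewrite inE RpE => z0.
under eq_integral do rewrite -expRD.
have -> : ((y + z)^-1 * expR (- s * y) * expR (- t * z))%:E =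
    ((expR (- s * y) * expR (- t * z))%:E * ((y + z)^-1)%:E)%E.
  by rewrite -EFinM; congr EFin; rewrite -mulrA mulrC.
rewrite -int_expR ?D// -ge0_integralZl//.
- apply: eq_integral => w _; rewrite -EFinM -!expRD; congr EFin.
  by congr expR; ring.
- apply/measurable_EFinP; apply: measurable_funTS.
  exact: (measurable_section (y + z) (mE _ _ m1 m2)).
Qed.

(** With both factors in the form of [aux0_poisson], integrating in [x] first
    gives [pi / 2 / (y + z)] by [int_poisson], and what remains is the double
    integral of [int_stieltjesE]. *)
Lemma int_aux_mul s t : 0 < s -> 0 < t ->
  (\int[mu]_(x in Rp) (aux 0 (x * s) * aux 0 (x * t))%:E =
   (pi / 2)%:E * \int[mu]_(w in Rp) ((s + w)^-1 * (t + w)^-1)%:E)%E.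
Proof.
move=> s0 t0.
pose k x y (s : R) : R := x / (x ^+ 2 + y ^+ 2) * expR (- s * y).
have k0 x y s' : 0 < x -> 0 < y -> 0 <= k x y s'.
  move=> x0 y0; rewrite mulr_ge0 ?expR_ge0// divr_ge0 ?(ltW x0)//.
  by rewrite addr_ge0 ?sqr_ge0.
have mk := measurable_poisson_laplace.
have maux c : measurable_fun setT (fun x : R => aux 0 (x * c)).
  by apply: measurableT_comp; [exact: measurable_aux|exact: measurable_funM].
have mk1 y s' : measurable_fun setT (fun x => k x y s').
  exact: (measurableT_comp (mk s') (measurable_pair2 y)).
have mk2 x s' : measurable_fun setT (fun y => k x y s').
  exact: (measurableT_comp (mk s') (measurable_pair1 x)).
transitivity (\int[mu]_(x in Rp) \int[mu]_(y in Rp) (k x y s * aux 0 (x * t))%:E)%E.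
  apply: eq_integral => x; rewrite inE RpE => x0.
  rewrite EFinM aux0_poisson// -ge0_integralZr//.
  - by apply/measurable_EFinP; apply: measurable_funTS; exact: mk2.
  - by move=> y; rewrite RpE => y0; rewrite lee_fin; exact: k0.
  - by rewrite lee_fin aux_ge0.
rewrite (tonelli_on (h := fun z => k z.1 z.2 s * aux 0 (z.1 * t)))//; last 2 first.
- apply: measurable_funM; first exact: mk.
  exact: (measurableT_comp (maux t) measurable_fst).
- by move=> x y; rewrite !RpE => x0 y0; rewrite mulr_ge0 ?aux_ge0// k0.
pose h (p : R * R) := (p.1 + p.2)^-1 * expR (- s * p.1) * expR (- t * p.2).
have mh : measurable_fun setT h.
  have m1 : measurable_fun setT (fst : R * R -> R) by exact: measurable_fst.
  have m2 : measurable_fun setT (snd : R * R -> R) by exact: measurable_snd.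
  apply: measurable_funM; first apply: measurable_funM.
  - by apply: (measurableT_comp measurable_inv); exact: measurable_funD.
  - by apply: measurableT_comp => //; exact: measurable_funM.
  - by apply: measurableT_comp => //; exact: measurable_funM.
have h0 y z : Rp y -> Rp z -> 0 <= h (y, z).
  rewrite !RpE => y0 z0; rewrite !mulr_ge0 ?expR_ge0// invr_ge0 /=; lra.
have pi20 : (0 <= (pi / 2 : R)%:E)%E by rewrite lee_fin divr_ge0// pi_ge0.
rewrite int_stieltjesE// -ge0_integralZl//; last 2 first.
- exact: (measurable_tonelli_on (h := h)).
- move=> y y0; apply: integral_ge0 => z z0; rewrite lee_fin; exact: (h0 y z).
apply: eq_integral => y; rewrite inE RpE => y0.
transitivity (\int[mu]_(x in Rp) \int[mu]_(z in Rp) (k x y s * k x z t)%:E)%E.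
  apply: eq_integral => x; rewrite inE RpE => x0.
  rewrite EFinM aux0_poisson// -ge0_integralZl//.
  - by apply/measurable_EFinP; apply: measurable_funTS; exact: mk2.
  - by move=> z; rewrite RpE => z0; rewrite lee_fin; exact: k0.
  - by rewrite lee_fin k0.
rewrite (tonelli_on (h := fun z => k z.1 y s * k z.1 z.2 t))//; last 2 first.
- apply: measurable_funM; last exact: mk.
  exact: (measurableT_comp (mk1 y s) measurable_fst).
- by move=> x z; rewrite !RpE => x0 z0; rewrite mulr_ge0 ?k0.
rewrite -ge0_integralZl//; last 2 first.
- apply/measurable_EFinP; apply: measurable_funTS.
  exact: (measurable_section y mh).
- by move=> z z0; rewrite lee_fin; apply: (h0 y z) => //; rewrite RpE.
apply: eq_integral => z; rewrite inE RpE => z0.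
transitivity ((expR (- s * y) * expR (- t * z))%:E *
   \int[mu]_(x in Rp) (x / (x ^+ 2 + y ^+ 2) * (x / (x ^+ 2 + z ^+ 2)))%:E)%E.
  rewrite -ge0_integralZl//.
  - by apply: eq_integral => x _; rewrite -EFinM; congr EFin; rewrite /k mulrACA mulrC.
  - apply/measurable_EFinP; apply: measurable_funTS.
    have e0 (y' : R) : (fun x => x / (x ^+ 2 + y' ^+ 2)) = (fun x => k x y' 0).
      by apply/funext => x; rewrite /k oppr0 mul0r expR0 mulr1.
    by apply: measurable_funM; rewrite e0; exact: mk1.
  - move=> x; rewrite RpE => x0; rewrite lee_fin mulr_ge0// divr_ge0 ?(ltW x0)//;
    by rewrite addr_ge0 ?sqr_ge0.
rewrite int_poisson// -!EFinM; congr EFin.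
by rewrite /h /=; set a := expR _; set b := expR _; set c := _^-1; ring.
Qed.

End AuxiliaryFunction.

(** * The damped Gram kernel *)

Section GramKernel.
Context {R : realType}.
Local Open Scope classical_set_scope.
Local Notation mu := (@lebesgue_measure R).
Local Notation Rp := (@Rp R).
Local Notation aux := (@aux R).
Implicit Types (eps s t a : R).

(** The value of the kernel on the half-line, where the Lommel function is
    known; see [lommel_kernelE]. *)
Definition explicit_kernel (z : R) : R := sin z - cos z + 2 / pi * aux 0 z.

Lemma measurable_sinM s : measurable_fun setT (fun x : R => sin (x * s)).
Proof.
by apply: continuous_measurable_fun => x; apply: is_derive_continuous; der.
Qed.

Lemma measurable_cosM s : measurable_fun setT (fun x : R => cos (x * s)).
Proof.
by apply: continuous_measurable_fun => x; apply: is_derive_continuous; der.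
Qed.

Lemma measurable_auxM s : measurable_fun setT (fun x : R => aux 0 (x * s)).
Proof.
by apply: measurableT_comp; [exact: measurable_aux|exact: measurable_funM].
Qed.

Lemma measurable_explicit_kernel : measurable_fun setT explicit_kernel.
Proof.
apply: measurable_funD.
  by apply: measurable_funB; apply: continuous_measurable_fun => x;
    apply: is_derive_continuous; der.
by apply: measurable_funM => //; exact: measurable_aux.
Qed.

Lemma integrable_expR_bounded eps (C : R) (f : R -> R) : 0 < eps ->
  measurable_fun setT f -> (forall x, 0 < x -> `|f x| <= C) ->
  mu.-integrable Rp (EFin \o (fun x => expR (- eps * x) * f x)).
Proof.
move=> e0 mf fC.
apply: (@integrable_le_norm R Rp _ (fun x => C * expR (- eps * x))) => //.
- apply: measurable_funTS; apply: measurable_funM => //.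
  by apply: measurableT_comp => //; exact: measurable_funM.
- move=> x; rewrite RpE => x0; rewrite normrM ger0_norm ?expR_ge0// mulrC.
  by rewrite ler_wpM2r ?expR_ge0// fC.
- by apply: integrable_scale => //; exact: integrable_expR.
Qed.

(** Fubini, with the Laplace transform of [f] taken first. *)
Lemma int_expR_aux eps t (f : R -> R) : 0 < eps -> 0 < t ->
  measurable_fun setT f -> (forall x, `|f x| <= 1) ->
  \int[mu]_(x in Rp) (expR (- eps * x) * (f x * aux 0 (x * t))) =
  \int[mu]_(r in Rp) ((1 + r ^+ 2)^-1 *
     \int[mu]_(x in Rp) (expR (- (eps + t * r) * x) * f x)).
Proof.
move=> e0 t0 mf f1.
pose h (p : R * R) := expR (- eps * p.1) * f p.1 * lap 0 (p.1 * t) p.2.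
have mh : measurable_fun setT h.
  have m1 : measurable_fun setT (fst : R * R -> R) by exact: measurable_fst.
  apply: measurable_funM.
    apply: measurable_funM; last exact: (measurableT_comp mf m1).
    by apply: measurableT_comp => //; exact: measurable_funM.
  apply: (measurableT_comp (@measurable_lap R 0)
    (g := fun p : R * R => (p.1 * t, p.2))).
  by apply: measurable_fun_pair; [exact: measurable_funM|exact: measurable_snd].
have hab x r : Rp x -> Rp r -> `|h (x, r)| <= expR (- eps * x) * (1 + r ^+ 2)^-1.
  rewrite !RpE => x0 r0; rewrite /h /= normrM (normrM (expR _)) (ger0_norm (expR_ge0 _)).
  have l0 := lap_ge0 0 (x * t) (ltW r0).
  rewrite (ger0_norm l0) ler_pM// ?mulr_ge0 ?expR_ge0//.
    by rewrite ler_piMr ?expR_ge0.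
  by rewrite lap0_le// ?mulr_ge0// ltW.
transitivity (\int[mu]_(x in Rp) \int[mu]_(r in Rp) h (x, r)).
  apply: eq_Rintegral => x; rewrite inE RpE => x0.
  have il : mu.-integrable Rp (EFin \o lap 0 (x * t)).
    exact: integrable_lap0 (mulr_ge0 (ltW x0) (ltW t0)).
  rewrite mulrA; exact/esym/(RintegralZl (mu := mu) (expR (- eps * x) * f x) _ il).
rewrite (Rintegral_swap _ _ (integrable_expR e0) (@integrable_cauchy R) mh hab)//.
apply: eq_Rintegral => r; rewrite inE RpE => r0.
have etr : 0 < eps + t * r by rewrite addr_gt0// mulr_gt0.
have ie : mu.-integrable Rp (EFin \o (fun x => expR (- (eps + t * r) * x) * f x)).
  by apply: (integrable_expR_bounded (C := 1)).
rewrite -(RintegralZl (mu := mu) _ _ ie)//; apply: eq_Rintegral => x _; rewrite /h /lap /= expr0 mul1r.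
have -> : - (eps + t * r) * x = - eps * x + - (x * t) * r by ring.
by rewrite expRD; set c := _^-1; ring.
Qed.

Lemma Lipschitz_sin s p q : 0 < s ->
  `|s / (p ^+ 2 + s ^+ 2) - s / (q ^+ 2 + s ^+ 2)| <= `|p - q| / s ^+ 2.
Proof.
move=> s0.
have D x : 0 < x ^+ 2 + s ^+ 2 by rewrite ltr_wpDl ?sqr_ge0 ?exprn_gt0.
have -> : s / (p ^+ 2 + s ^+ 2) - s / (q ^+ 2 + s ^+ 2) =
    (p - q) * (- s * (p + q)) / ((p ^+ 2 + s ^+ 2) * (q ^+ 2 + s ^+ 2)).
  by field; rewrite !gt_eqF ?D.
rewrite -mulrA normrM ler_wpM2l// normrM normfV (ger0_norm (ltW (mulr_gt0 (D p) (D q)))).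
rewrite ler_pdivrMr ?mulr_gt0// ler_pdivlMl ?exprn_gt0//.
have h : `|- s * (p + q)| <= ((p ^+ 2 + s ^+ 2) + (q ^+ 2 + s ^+ 2)) / 2.
  have := (sqr_ge0 (p - s), sqr_ge0 (p + s), sqr_ge0 (q - s), sqr_ge0 (q + s)).
  by move=> [[[*] ] *]; rewrite ler_norml; apply/andP; split; nra.
apply: (le_trans (ler_wpM2l (sqr_ge0 s) h)).
have := (D p, D q, sqr_ge0 p, sqr_ge0 q).
set P := p ^+ 2; set Q := q ^+ 2; set S := s ^+ 2 => -[[[*] ] *]; nra.
Qed.

Lemma Lipschitz_cos s p q : 0 < s ->
  `|p / (p ^+ 2 + s ^+ 2) - q / (q ^+ 2 + s ^+ 2)| <= `|p - q| / s ^+ 2.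
Proof.
move=> s0.
have D x : 0 < x ^+ 2 + s ^+ 2 by rewrite ltr_wpDl ?sqr_ge0 ?exprn_gt0.
have -> : p / (p ^+ 2 + s ^+ 2) - q / (q ^+ 2 + s ^+ 2) =
    (p - q) * (s ^+ 2 - p * q) / ((p ^+ 2 + s ^+ 2) * (q ^+ 2 + s ^+ 2)).
  by field; rewrite !gt_eqF ?D.
rewrite -mulrA normrM ler_wpM2l// normrM normfV (ger0_norm (ltW (mulr_gt0 (D p) (D q)))).
rewrite ler_pdivrMr ?mulr_gt0// ler_pdivlMl ?exprn_gt0//.
have h : `|s ^+ 2 - p * q| <= s ^+ 2 + `|p| * `|q|.
  by apply: (le_trans (ler_normB _ _)); rewrite (normrM p q) (ger0_norm (sqr_ge0 s)).
apply: (le_trans (ler_wpM2l (sqr_ge0 s) h)).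
rewrite -(real_normK (num_real p)) -(real_normK (num_real q)).
have := (sqr_ge0 (s * `|p| - s * `|q|), sqr_ge0 (`|p| * `|q|)); nra.
Qed.

(** Damping shifts the argument of the Lipschitz function [g] by [eps], and the
    Cauchy density has mass [pi / 2]. *)
Lemma int_cauchy_approx eps s t (g : R -> R) (l : R) : 0 < eps -> 0 < s -> 0 < t ->
  measurable_fun setT g ->
  (forall p q, `|g p - g q| <= `|p - q| / s ^+ 2) ->
  (forall p, `|g p| <= 1 / s) ->
  \int[mu]_(r in Rp) ((1 + r ^+ 2)^-1 * g (t * r)) = l ->
  `|\int[mu]_(r in Rp) ((1 + r ^+ 2)^-1 * g (eps + t * r)) - l| <=
    eps * (pi / 2) / s ^+ 2.
Proof.
move=> e0 s0 t0 mg Lg bg <-.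
have V r : 0 <= (1 + r ^+ 2)^-1 :> R by rewrite invr_ge0 addr_ge0 ?sqr_ge0.
have ic c : mu.-integrable Rp (EFin \o (fun r => (1 + r ^+ 2)^-1 * g (c + t * r))).
  apply: (@integrable_le_norm R Rp _ (fun r => 1 / s * (1 + r ^+ 2)^-1)) => //.
  - apply: measurable_funTS; apply: measurable_funM.
      apply: (measurableT_comp (@measurable_inv R)).
      by apply: measurable_funD => //; exact: measurable_funX.
    by apply: measurableT_comp => //; apply: measurable_funD.
  - move=> r _; rewrite normrM mulrC (ger0_norm (V r)).
    by rewrite ler_wpM2r ?bg.
  - by apply: integrable_scale => //; exact: integrable_cauchy.
have ic0 : mu.-integrable Rp (EFin \o (fun r => (1 + r ^+ 2)^-1 * g (t * r))).
  by have := ic 0; under eq_fun do rewrite add0r.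
have iL : mu.-integrable Rp (EFin \o (fun r => eps / s ^+ 2 * (1 + r ^+ 2)^-1)).
  by apply: integrable_scale => //; exact: integrable_cauchy.
rewrite -RintegralB//; apply: le_trans (le_normr_Rintegral _ _) _ => //.
  exact: integrable_sub.
have -> : eps * (pi / 2) / s ^+ 2 =
    \int[mu]_(r in Rp) (eps / s ^+ 2 * (1 + r ^+ 2)^-1).
  rewrite RintegralZl//; last exact: integrable_cauchy.
  by rewrite /Rintegral int_cauchy/=; ring.
apply: le_Rintegral => //.
  by apply/integrable_norm; exact: integrable_sub.
move=> r _; rewrite -mulrBr normrM (ger0_norm (V r)) mulrC ler_wpM2r//.
by rewrite (le_trans (Lg _ _))// addrK ger0_norm// ltW.
Qed.

Section expansion.
Variables (eps : R) (e0 : 0 < eps).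

Let S t s := \int[mu]_(x in Rp) (expR (- eps * x) * (sin (x * s) * aux 0 (x * t))).
Let C t s := \int[mu]_(x in Rp) (expR (- eps * x) * (cos (x * s) * aux 0 (x * t))).

Lemma int_sin_aux s t : 0 < s -> 0 < t -> s != t ->
  `|S t s - pi / 2 / (s + t)| <= eps * (pi / 2) / s ^+ 2.
Proof.
move=> s0 t0 st.
rewrite /S int_expR_aux//; last 2 first.
- exact: measurable_sinM.
- by move=> x; exact: sin_max.
under eq_Rintegral => r.
  rewrite inE RpE => r0; under eq_Rintegral do rewrite (mulrC _ s).
  rewrite int_expR_sin; last by rewrite addr_gt0// mulr_gt0.
  over.
apply: (int_cauchy_approx (g := fun p => s / (p ^+ 2 + s ^+ 2))) => //.
- apply: measurable_funM => //; apply: (measurableT_comp (@measurable_inv R)).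
  by apply: measurable_funD => //; exact: measurable_funX.
- by move=> p q; exact: Lipschitz_sin.
- move=> p; have D : 0 < p ^+ 2 + s ^+ 2 by rewrite ltr_wpDl ?sqr_ge0 ?exprn_gt0.
  rewrite ger0_norm; last by rewrite divr_ge0 ?(ltW s0) ?(ltW D).
  by rewrite ler_pdivrMr// mul1r ler_pdivlMl// -expr2 lerDr sqr_ge0.
- by rewrite /Rintegral int_cauchy_sin.
Qed.

Lemma int_cos_aux s t : 0 < s -> 0 < t -> s != t ->
  `|C t s - t / (s + t) * logmean s t| <= eps * (pi / 2) / s ^+ 2.
Proof.
move=> s0 t0 st.
rewrite /C int_expR_aux//; last 2 first.
- exact: measurable_cosM.
- by move=> x; exact: cos_max.
under eq_Rintegral => r.
  rewrite inE RpE => r0; under eq_Rintegral do rewrite (mulrC _ s).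
  rewrite int_expR_cos; last by rewrite addr_gt0// mulr_gt0.
  over.
apply: (int_cauchy_approx (g := fun p => p / (p ^+ 2 + s ^+ 2))) => //.
- apply: measurable_funM => //; apply: (measurableT_comp (@measurable_inv R)).
  by apply: measurable_funD => //; exact: measurable_funX.
- by move=> p q; exact: Lipschitz_cos.
- move=> p; have D : 0 < p ^+ 2 + s ^+ 2 by rewrite ltr_wpDl ?sqr_ge0 ?exprn_gt0.
  rewrite normrM normfV (ger0_norm (ltW D)) ler_pdivrMr// mul1r ler_pdivlMl//.
  rewrite -(real_normK (num_real p)).
  by have := (sqr_ge0 (s - `|p|), sqr_ge0 s, sqr_ge0 `|p|); nra.
- by rewrite /Rintegral int_cauchy_cos.
Qed.

Definition damped_gram s t := \int[mu]_(x in Rp)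
  (expR (- eps * x) * (explicit_kernel (x * s) * explicit_kernel (x * t))).

(** The loss caused by the damping in the integral of a product of values of
    [aux 0]. As [aux 0] is nonincreasing, the loss at [s, t >= a] is largest at
    [s = t = a], which makes the estimate uniform. *)
Definition defect a := \int[mu]_(x in Rp)
  ((1 - expR (- eps * x)) * (aux 0 (x * a) * aux 0 (x * a))).

End expansion.

Lemma integrable_aux_mul s t : 0 < s -> 0 < t ->
  mu.-integrable Rp (EFin \o (fun x => aux 0 (x * s) * aux 0 (x * t))).
Proof.
move=> s0 t0; have : exists l, (\int[mu]_(w in Rp) ((s + w)^-1 * (t + w)^-1)%:E = l%:E)%E.
  have [<-|st] := eqVneq s t; first by eexists; exact: int_stieltjes_diag.
  by eexists; exact: int_stieltjes.
move=> [l hl]; apply: (@ge0_integrable_Rp R _ (pi / 2 * l)).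
- by apply: measurable_funTS; apply: measurable_funM; exact: measurable_auxM.
- by move=> x _; rewrite mulr_ge0 ?aux_ge0.
- by rewrite int_aux_mul// hl.
Qed.

Lemma damp_ge0 eps (x : R) : 0 < eps -> 0 < x -> 0 <= 1 - expR (- eps * x).
Proof.
by move=> e0 x0; rewrite subr_ge0 -expR0 ler_expR mulNr oppr_le0 mulr_ge0// ltW.
Qed.

Lemma integrable_damped eps s t : 0 < eps -> 0 < s -> 0 < t ->
  mu.-integrable Rp (EFin \o (fun x =>
    (1 - expR (- eps * x)) * (aux 0 (x * s) * aux 0 (x * t)))).
Proof.
move=> e0 s0 t0.
apply: (@integrable_le_norm R Rp _ (fun x => aux 0 (x * s) * aux 0 (x * t))) => //.
- apply: measurable_funTS; apply: measurable_funM.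
    by apply: measurable_funB => //; apply: measurableT_comp => //.
  by apply: measurable_funM; exact: measurable_auxM.
- move=> x; rewrite RpE => x0.
  rewrite ger0_norm ?mulr_ge0 ?aux_ge0 ?damp_ge0//.
  by rewrite ler_piMl ?mulr_ge0 ?aux_ge0// gerBl expR_ge0.
- exact: integrable_aux_mul.
Qed.

Lemma int_aux_aux eps a s t : 0 < eps -> 0 < a -> a <= s -> a <= t -> s != t ->
  `|\int[mu]_(x in Rp) (expR (- eps * x) * (aux 0 (x * s) * aux 0 (x * t)))
    - pi / 2 * logmean s t| <= defect eps a.
Proof.
move=> e0 a0 as_ at_ st; have s0 := lt_le_trans a0 as_; have t0 := lt_le_trans a0 at_.
have <- : \int[mu]_(x in Rp) (aux 0 (x * s) * aux 0 (x * t)) = pi / 2 * logmean s t.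
  by rewrite /Rintegral int_aux_mul// int_stieltjes.
rewrite distrC -RintegralB//; [|exact: integrable_aux_mul|]; last first.
  apply: (integrable_expR_bounded (C := pi / 2 * (pi / 2))) => //.
    by apply: measurable_funM; exact: measurable_auxM.
  by move=> x x0; rewrite normrM ler_pM// aux0_norm_le// mulr_ge0// ltW.
have E x : aux 0 (x * s) * aux 0 (x * t) - expR (- eps * x) *
    (aux 0 (x * s) * aux 0 (x * t)) =
    (1 - expR (- eps * x)) * (aux 0 (x * s) * aux 0 (x * t)).
  by rewrite mulrBl mul1r.
under eq_Rintegral do rewrite E.
have i1 := integrable_damped e0 s0 t0.
apply: (le_trans (le_normr_Rintegral _ i1)) => //.
apply: le_Rintegral => //.
- exact/integrable_norm.
- exact: integrable_damped.
move=> x; rewrite RpE => x0; rewrite ger0_norm ?mulr_ge0 ?aux_ge0 ?damp_ge0//.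
rewrite ler_wpM2l ?damp_ge0// ler_pM ?aux_ge0//;
  by apply: aux0_nonincreasing; rewrite ?ler_pM2l// mulr_ge0// ltW.
Qed.

Lemma logmeanC s t : logmean s t = logmean t s.
Proof. by rewrite /logmean -[t - s]opprB invrN mulrN -mulNr opprB. Qed.

Lemma rational_approx eps a s t : 0 < eps -> 0 < a -> a <= s -> 0 < t ->
  `|(s + t) / (eps ^+ 2 + (s + t) ^+ 2) - (s + t)^-1| <= eps / a ^+ 2 /\
  `|(s + t)^-1 - (eps + s + t)^-1| <= eps / a ^+ 2.
Proof.
move=> e0 a0 as_ t0; have ast : a <= s + t by lra.
have st0 : 0 < s + t by lra.
have a2 : 0 < a ^+ 2 by exact: exprn_gt0.
have aast : a ^+ 2 <= (s + t) ^+ 2 by rewrite ler_pXn2r// nnegrE ltW.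
split.
  have D : 0 < eps ^+ 2 + (s + t) ^+ 2 by rewrite addr_gt0 ?exprn_gt0.
  have -> : (s + t) / (eps ^+ 2 + (s + t) ^+ 2) - (s + t)^-1 =
      - (eps * (eps / ((s + t) * (eps ^+ 2 + (s + t) ^+ 2)))).
    by field; rewrite (gt_eqF D) (gt_eqF st0).
  have D' : 0 < (s + t) * (eps ^+ 2 + (s + t) ^+ 2) by exact: mulr_gt0.
  rewrite normrN ger0_norm; last exact: mulr_ge0 (ltW e0) (divr_ge0 (ltW e0) (ltW D')).
  rewrite ler_wpM2l ?(ltW e0)// ler_pdivrMr// ler_pdivlMl//.
  clear D D' ast; move: st0 aast; move: (s + t) => u u0 aau.
  apply: (le_trans (ler_wpM2r (ltW e0) aau)).
  by rewrite expr2 -mulrA ler_wpM2l ?(ltW u0)//; have := sqr_ge0 (eps - u); nra.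
have est0 : 0 < eps + s + t by lra.
have -> : (s + t)^-1 - (eps + s + t)^-1 = eps * ((s + t) * (eps + s + t))^-1.
  by field; rewrite (gt_eqF est0) (gt_eqF st0).
have D' : 0 < (s + t) * (eps + s + t) by exact: mulr_gt0.
rewrite ger0_norm; last by apply: (mulr_ge0 (ltW e0)); rewrite invr_ge0 ltW.
rewrite ler_wpM2l ?(ltW e0)// lef_pV2 ?posrE//.
by apply: (le_trans aast); rewrite expr2 ler_pM2l//; lra.
Qed.

Lemma scale_bound eps a c (d : R) : 0 < a -> a <= c -> 0 < eps ->
  `|d| <= eps * (pi / 2) / c ^+ 2 -> `|2 / pi * d| <= eps / a ^+ 2.
Proof.
move=> a0 ac e0 hd; have pi0 := @pi_gt0 R; have c0 := lt_le_trans a0 ac.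
rewrite normrM ger0_norm; last exact: divr_ge0 _ (ltW pi0).
rewrite mulrC -ler_pdivlMr ?divr_gt0//; apply: (le_trans hd).
have -> : eps / a ^+ 2 / (2 / pi) = eps * (pi / 2) * (a ^+ 2)^-1.
  by clear hd; move: (pi : R) pi0 => p p0; field; rewrite (gt_eqF a0) (gt_eqF p0).
rewrite ler_wpM2l//; first exact: mulr_ge0 (ltW e0) (divr_ge0 (ltW pi0) _).
by rewrite lef_pV2 ?posrE ?exprn_gt0// ler_pXn2r ?nnegrE ?(ltW a0) ?(ltW c0).
Qed.

(** The logarithmic means cancel, and the three multiples of [(s + t)^-1] add up
    to one. *)
Lemma gram_algebra s t (P Q w L i1 i2 i3 i4 i5 : R) : s + t != 0 ->
  P - Q + 2 / pi * (i1 - i2 + i3 - i4) + (2 / pi) ^+ 2 * i5 - (P + w) =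
  - (Q - (s + t)^-1) + ((s + t)^-1 - w) +
  (2 / pi * (i1 - pi / 2 / (s + t)) - 2 / pi * (i2 - t / (s + t) * L) +
   2 / pi * (i3 - pi / 2 / (t + s)) - 2 / pi * (i4 - s / (t + s) * L)) +
  (2 / pi) ^+ 2 * (i5 - pi / 2 * L).
Proof.
move=> st; have pi0 : pi != 0 :> R by rewrite gt_eqF// pi_gt0.
move: (pi : R) pi0 => p p0.
by rewrite (addrC t s); field; rewrite p0 st.
Qed.

Lemma sum_bound (B D z w q1 q2 q3 q4 q5 : R) : `|z| <= B -> `|w| <= B ->
  `|q1| <= B -> `|q2| <= B -> `|q3| <= B -> `|q4| <= B -> `|q5| <= D ->
  `|- z + w + (q1 - q2 + q3 - q4) + q5| <= 6 * B + D.
Proof.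
rewrite !ler_norml => /andP[? ?] /andP[? ?] /andP[? ?] /andP[? ?] /andP[? ?].
by move=> /andP[? ?] /andP[? ?]; apply/andP; split; lra.
Qed.

(** In the expansion of the product of two values of the kernel, the
    trigonometric part gives the Poisson kernel and [- (s + t)^-1], the products
    of sines with [aux 0] give [2 * (s + t)^-1], and the logarithmic means coming
    from the cosines and from the square of [aux 0] are opposite. *)
Lemma damped_gram_approx eps a s t : 0 < eps -> 0 < a -> a <= s -> a <= t -> s != t ->
  `|damped_gram eps s t - (eps / (eps ^+ 2 + (s - t) ^+ 2) + (eps + s + t)^-1)| <=
  6 * eps / a ^+ 2 + 4 / pi ^+ 2 * defect eps a.
Proof.
move=> e0 a0 as_ at_ st; have s0 := lt_le_trans a0 as_; have t0 := lt_le_trans a0 at_.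
have pi0 := @pi_gt0 R.
pose I (f : R -> R) := \int[mu]_(x in Rp) (expR (- eps * x) * f x).
have S1 := int_sin_aux e0 s0 t0 st.
have ts : t != s by rewrite eq_sym.
have S2 := int_sin_aux e0 t0 s0 ts.
have C1 := int_cos_aux e0 s0 t0 st.
have C2 := int_cos_aux e0 t0 s0 ts.
have A1 := int_aux_aux e0 a0 as_ at_ st.
have iE (f : R -> R) C := @integrable_expR_bounded eps C f e0.
have mS c := @measurable_sinM c; have mC c := @measurable_cosM c.
have mA c := @measurable_auxM c.
have bA c x : 0 < c -> 0 < x -> `|aux 0 (x * c)| <= pi / 2.
  by move=> c0 x0; rewrite aux0_norm_le// mulr_ge0// ltW.
have iSA c d : 0 < d -> mu.-integrable Rp (EFin \o
    (fun x => expR (- eps * x) * (sin (x * c) * aux 0 (x * d)))).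
  move=> d0; apply: (iE _ (1 * (pi / 2))); first exact: measurable_funM.
  by move=> x x0; rewrite normrM ler_pM// ?sin_max// bA.
have iCA c d : 0 < d -> mu.-integrable Rp (EFin \o
    (fun x => expR (- eps * x) * (cos (x * c) * aux 0 (x * d)))).
  move=> d0; apply: (iE _ (1 * (pi / 2))); first exact: measurable_funM.
  by move=> x x0; rewrite normrM ler_pM// ?cos_max// bA.
have iAA : mu.-integrable Rp (EFin \o
    (fun x => expR (- eps * x) * (aux 0 (x * s) * aux 0 (x * t)))).
  apply: (iE _ (pi / 2 * (pi / 2))); first exact: measurable_funM.
  by move=> x x0; rewrite normrM ler_pM// bA.
have iC c : mu.-integrable Rp (EFin \o (fun x => expR (- eps * x) * cos (c * x))).
  apply: (iE _ 1); last by move=> x _; exact: cos_max.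
  have -> : (fun x => cos (c * x)) = (fun x => cos (x * c)); last exact: mC.
  by apply/funext => x; rewrite mulrC.
have iS c : mu.-integrable Rp (EFin \o (fun x => expR (- eps * x) * sin (c * x))).
  apply: (iE _ 1); last by move=> x _; exact: sin_max.
  have -> : (fun x => sin (c * x)) = (fun x => sin (x * c)); last exact: mS.
  by apply/funext => x; rewrite mulrC.
pose ok f := mu.-integrable Rp (EFin \o (fun x => expR (- eps * x) * f x)).
have okD f g : ok f -> ok g -> ok (fun x => f x + g x).
  move=> fi gi; rewrite /ok; under eq_fun do rewrite mulrDr.
  exact: integrable_add.
have okB f g : ok f -> ok g -> ok (fun x => f x - g x).
  move=> fi gi; rewrite /ok; under eq_fun do rewrite mulrBr.
  exact: integrable_sub.
have okZ k f : ok f -> ok (fun x => k * f x).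
  move=> fi; rewrite /ok; under eq_fun do rewrite mulrCA.
  exact: integrable_scale.
have ID f g : ok f -> ok g -> I (fun x => f x + g x) = I f + I g.
  move=> fi gi; rewrite /I -(RintegralD (mu := mu) _ fi gi)//.
  by apply: eq_Rintegral => x _; rewrite mulrDr.
have IB f g : ok f -> ok g -> I (fun x => f x - g x) = I f - I g.
  move=> fi gi; rewrite /I -(RintegralB (mu := mu) _ fi gi)//.
  by apply: eq_Rintegral => x _; rewrite mulrBr.
have IZ k f : ok f -> I (fun x => k * f x) = k * I f.
  move=> fi; rewrite /I -(RintegralZl (mu := mu) k _ fi)//.
  by apply: eq_Rintegral => x _; rewrite mulrCA.
have ME : damped_gram eps s t = eps / (eps ^+ 2 + (s - t) ^+ 2)
   - (s + t) / (eps ^+ 2 + (s + t) ^+ 2)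
   + 2 / pi * (I (fun x => sin (x * s) * aux 0 (x * t))
             - I (fun x => cos (x * s) * aux 0 (x * t))
             + I (fun x => sin (x * t) * aux 0 (x * s))
             - I (fun x => cos (x * t) * aux 0 (x * s)))
   + (2 / pi) ^+ 2 * I (fun x => aux 0 (x * s) * aux 0 (x * t)).
  have o1 := iSA s _ t0; have o2 := iCA s _ t0.
  have o3 := iSA t _ s0; have o4 := iCA t _ s0.
  have o12 := okB _ _ o1 o2; have o123 := okD _ _ o12 o3.
  have o1234 := okB _ _ o123 o4; have o5 := okZ (2 / pi) _ o1234.
  have o6 := okZ ((2 / pi) ^+ 2) _ iAA.
  have o7 := okB _ _ (iC (s - t)) (iS (s + t)).
  have o8 := okD _ _ o7 o5.
  rewrite -int_expR_cos// -int_expR_sin// -!/(I _).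
  rewrite -(IB _ _ o1 o2) -(ID _ _ o12 o3) -(IB _ _ o123 o4) -(IZ _ _ o1234).
  rewrite -(IZ _ _ iAA) -(IB _ _ (iC (s - t)) (iS (s + t))) -(ID _ _ o7 o5).
  rewrite -(ID _ _ o8 o6) /damped_gram.
  apply: eq_Rintegral => x _; congr (_ * _); rewrite /explicit_kernel.
  have -> : (s - t) * x = x * s - x * t by ring.
  have -> : (s + t) * x = x * s + x * t by ring.
  by rewrite cosB sinD; ring.
set B := eps / a ^+ 2.
have a2 : 0 < a ^+ 2 by rewrite exprn_gt0.
have [L1 L2] := rational_approx e0 a0 as_ t0.
have {}S1 := scale_bound a0 as_ e0 S1; have {}S2 := scale_bound a0 at_ e0 S2.
have {}C1 := scale_bound a0 as_ e0 C1; have {}C2 := scale_bound a0 at_ e0 C2.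
have {}A1 : `|(2 / pi) ^+ 2 * (I (fun x => aux 0 (x * s) * aux 0 (x * t)) -
    pi / 2 * logmean s t)| <= 4 / pi ^+ 2 * defect eps a.
  rewrite normrM ger0_norm ?sqr_ge0//; have -> : (2 / pi) ^+ 2 = 4 / pi ^+ 2 :> R.
    by rewrite expr_div_n -natrX.
  by rewrite ler_wpM2l// divr_ge0// sqr_ge0.
rewrite ME; rewrite (logmeanC t s) in C2.
have -> : 6 * eps / a ^+ 2 = 6 * B by rewrite /B mulrA.
have st1 : s + t != 0 by rewrite gt_eqF// addr_gt0.
rewrite (gram_algebra _ _ _ (logmean s t) _ _ _ _ _ st1).
exact: (sum_bound L1 L2 S1 C1 S2 C2 A1).
Qed.

Lemma cvg_defect (a : R) : 0 < a ->
  defect n.+1%:R^-1 a @[n --> \oo] --> (0 : R).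
Proof.
move=> a0.
pose F (n : nat) (x : R) := (1 - expR (- n.+1%:R^-1 * x)) * (aux 0 (x * a) * aux 0 (x * a)).
have iF n : mu.-integrable Rp (EFin \o F n) by apply: integrable_damped.
rewrite -[X in _ --> X](Rintegral0 Rp).
apply: (Rintegral_dominated_cvg (g := fun x => aux 0 (x * a) * aux 0 (x * a))) => //.
- by move=> n; have /measurable_int/measurable_EFinP := iF n.
- exact: integrable_aux_mul.
- move=> n x; rewrite RpE => x0.
  rewrite /F ger0_norm ?mulr_ge0 ?aux_ge0 ?damp_ge0//.
  by rewrite ler_piMl ?mulr_ge0 ?aux_ge0// gerBl expR_ge0.
- apply: aeW => x _; rewrite /F.
  rewrite -(mul0r (aux 0 (x * a) * aux 0 (x * a))); apply: cvgMr_tmp.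
  have e0 : - n.+1%:R^-1 * x @[n --> \oo] --> - 0 * x.
    by apply: cvgMr_tmp; apply: cvgN; exact: cvg_harmonic.
  have : expR (- n.+1%:R^-1 * x) @[n --> \oo] --> expR (- 0 * x).
    by apply: continuous_cvg e0; exact: continuous_expR.
  rewrite oppr0 mul0r expR0 => e1.
  by rewrite -(subrr 1); apply: cvgB e1; exact: cvg_cst.
Qed.

End GramKernel.

(** * The Poisson kernel as an approximate identity *)

Section PoissonKernel.
Context {R : realType}.
Local Open Scope classical_set_scope.
Local Notation mu := (@lebesgue_measure R).
Implicit Types (eps s t a b : R).

Definition poisson eps (h : R) : R := eps / (eps ^+ 2 + h ^+ 2).

Lemma poisson_ge0 eps h : 0 < eps -> 0 <= poisson eps h.
Proof. by move=> e0; rewrite divr_ge0 ?(ltW e0)// addr_ge0 ?sqr_ge0. Qed.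

Lemma poisson_le eps h : 0 < eps -> poisson eps h <= eps^-1.
Proof.
move=> e0; have D : 0 < eps ^+ 2 + h ^+ 2 by rewrite ltr_wpDr ?sqr_ge0 ?exprn_gt0.
by rewrite ler_pdivrMr// ler_pdivlMl// -expr2 lerDl sqr_ge0.
Qed.

Lemma is_derive_poisson eps s t : 0 < eps ->
  is_derive t 1 (fun t => atan ((t - s) / eps)) (poisson eps (s - t)).
Proof.
move=> e0; have D : eps ^+ 2 + (s - t) ^+ 2 != 0.
  by rewrite gt_eqF// ltr_wpDr ?sqr_ge0 ?exprn_gt0.
deriv; rewrite /poisson; field.
by rewrite D gt_eqF.
Qed.

Lemma continuous_poisson eps s : 0 < eps -> continuous (fun t => poisson eps (s - t)).
Proof.
move=> e0 t; apply: is_derive_continuous; rewrite /poisson; der.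
by rewrite gt_eqF// ltr_wpDr ?sqr_ge0 ?exprn_gt0.
Qed.

Lemma measurable_poisson eps s : 0 < eps ->
  measurable_fun setT (fun t => poisson eps (s - t)).
Proof. by move=> e0; apply: continuous_measurable_fun; exact: continuous_poisson. Qed.

Lemma measurable_poisson2 eps :
  measurable_fun setT (fun p : R * R => poisson eps (p.1 - p.2)).
Proof.
apply: measurable_funM => //; apply: (measurableT_comp measurable_inv).
apply: measurable_funD => //; apply: measurable_funX.
exact: measurable_funB.
Qed.

Lemma int_poisson_itv eps s a b : 0 < eps -> a < b ->
  (\int[mu]_(t in `[a, b]) (poisson eps (s - t))%:E =
   (atan ((b - s) / eps) - atan ((a - s) / eps))%:E)%E.
Proof.
move=> e0 ab.
have dF := fun t => is_derive_poisson s t e0.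
have cF : continuous (fun t => atan ((t - s) / eps)).
  by move=> t; apply: is_derive_continuous; exact: dF.
rewrite (@continuous_FTC2 _ _ (fun t => atan ((t - s) / eps)))//.
- exact/continuous_subspaceT/continuous_poisson.
- split.
  + by move=> t _; have [] := dF t.
  + by apply: cvg_at_right_filter; exact: cF.
  + by apply: cvg_at_left_filter; exact: cF.
- by move=> t _; rewrite derive1E; have [_ ->] := dF t.
Qed.

Lemma integrable_poisson eps s a b : 0 < eps ->
  mu.-integrable `[a, b] (EFin \o (fun t => poisson eps (s - t))).
Proof.
move=> e0; apply: continuous_compact_integrable; first exact: segment_compact.
exact/continuous_subspaceT/continuous_poisson.
Qed.

Lemma int_poisson_lepi eps s a b : 0 < eps -> a < b ->
  \int[mu]_(t in `[a, b]) poisson eps (s - t) <= pi.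
Proof.
move=> e0 ab; rewrite /Rintegral int_poisson_itv//=.
by have := (atan_ltpi2 ((b - s) / eps), atan_gtNpi2 ((a - s) / eps)) => -[]; lra.
Qed.

(** At a Lebesgue point [s] of the bounded function [g], the part of the kernel
    over [ball s (L * eps)] is controlled by the mean oscillation of [g], since
    the kernel is at most [eps^-1] there; its part outside has mass at most
    [pi - 2 * atan L]. *)
Lemma poisson_oscillation (g : R -> R) (M eps s a b L : R) : 0 < eps -> 0 < L ->
  measurable_fun setT g -> (forall t : R, `|g t| <= M) ->
  a < s - L * eps -> s + L * eps < b ->
  \int[mu]_(t in `[a, b]) (`|g t - g s| * poisson eps (s - t)) <=
    2 * L * fine (davg g s (L * eps)) + 2 * M * (pi - 2 * atan L).
Proof.
move=> e0 L0 mg gM asL sLb.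
have M0 : 0 <= M by apply: le_trans (gM 0).
set r := L * eps; have r0 : 0 < r by exact: mulr_gt0.
rewrite -/r in asL sLb.
set E : set R := `[a, b]; set J : set R := `[s - r, s + r].
pose F t := `|g t - g s| * poisson eps (s - t).
have mE : measurable E by exact: measurable_itv.
have mJ : measurable J by exact: measurable_itv.
have mEJ : measurable (E `\` J) by apply: measurableD; exact: measurable_itv.
have EJ : J `|` (E `\` J) = E.
  apply: setDUK => t; rewrite /J /E /= !in_itv/= => /andP[? ?].
  by apply/andP; split; lra.
have dJ : [disjoint J & E `\` J] by apply/disj_setPS => t [? []].
have mF : measurable_fun setT F.
  apply: measurable_funM; last exact: measurable_poisson.
  by apply: measurableT_comp => //; exact: measurable_funB.
have osc t : `|g t - g s| <= 2 * M.
  by rewrite (le_trans (ler_normB _ _))// (le_trans (lerD (gM t) (gM s)))//; lra.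
have iP := integrable_poisson s a b e0.
have iF : mu.-integrable E (EFin \o F).
  apply: (@integrable_le_norm R _ _ (fun t => 2 * M * poisson eps (s - t))) => //.
  - exact: measurable_funTS.
  - move=> t _; rewrite /F normrM normr_id (ger0_norm (poisson_ge0 _ _))//.
    by rewrite ler_wpM2r ?poisson_ge0.
  - exact: integrable_scale.
have iO : mu.-integrable J (EFin \o (fun t => `|g t - g s|)).
  apply: (@integrable_le_norm R _ _ (fun t => 2 * M)) => //.
  - apply: measurable_funTS; apply: measurableT_comp => //; exact: measurable_funB.
  - by move=> t _; rewrite normr_id.
  - apply: continuous_compact_integrable; first exact: segment_compact.
    by apply: continuous_subspaceT => t; exact: cvg_cst.
have JE : J `<=` E by rewrite -EJ; exact: subsetUl.
have DE : E `\` J `<=` E by exact: subDsetl.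
rewrite -/E -EJ -/(F _) Rintegral_setU//; last by rewrite EJ.
apply: lerD.
  apply: (@le_trans _ _ (\int[mu]_(t in J) (eps^-1 * `|g t - g s|))).
    apply: le_Rintegral => //.
    + exact: integrableS iF.
    + exact: integrable_scale.
    + by move=> t _; rewrite /F mulrC ler_wpM2r// poisson_le.
  rewrite RintegralZl// ler_pdivrMl// mulrCA mulrA.
  have -> : \int[mu]_(t in J) `|g t - g s| = 2 * r * fine (davg g s r).
    set I : set R := `]s - r, s + r[.
    have IJ : I `<=` J.
      by move=> t; rewrite /I /J /= !in_itv/= => /andP[/ltW -> /ltW ->].
    have iB : mu.-integrable I (EFin \o (fun t => `|g t - g s|)).
      by apply: integrableS iO => //; exact: measurable_itv.
    have -> : davg g s r =
        (((r *+ 2)^-1)%:E * \int[mu]_(t in I) (`|g t - g s|)%:E)%E.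
      rewrite /davg /iavg lebesgue_measure_ball ?(ltW r0)// ball_itv inver.
      by rewrite mulrn_eq0 /= gt_eqF.
    rewrite fineM//; last by apply: integrable_fin_num iB; exact: measurable_itv.
    rewrite /= mulr2n mulrA.
    have -> : 2 * r * (r + r)^-1 = 1 by field; rewrite gt_eqF//; lra.
    rewrite mul1r /Rintegral; congr fine.
    rewrite /J /I -integral_itv_obnd_cbnd; last first.
      apply: measurable_funS (measurable_int mu iO) => //.
      by move=> t; rewrite /J /= !in_itv/= => /andP[/ltW -> ->].
    rewrite -integral_itv_bndo_bndc//.
    exact: (measurable_funS _ IJ (measurable_int mu iO)).
  by rewrite /r; lra.
apply: (@le_trans _ _ (\int[mu]_(t in E `\` J) (2 * M * poisson eps (s - t)))).
  apply: le_Rintegral => //.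
  + exact: integrableS iF.
  + by apply: integrable_scale => //; exact: integrableS iP.
  + by move=> t _; rewrite /F ler_wpM2r// poisson_ge0.
rewrite RintegralZl//; last exact: integrableS iP.
rewrite ler_wpM2l ?mulr_ge0//.
have : \int[mu]_(t in E) poisson eps (s - t) = \int[mu]_(t in J) poisson eps (s - t)
    + \int[mu]_(t in E `\` J) poisson eps (s - t).
  by rewrite -{1}EJ Rintegral_setU// EJ.
have -> : \int[mu]_(t in J) poisson eps (s - t) = 2 * atan L.
  rewrite /Rintegral int_poisson_itv//=; last by lra.
  have -> : (s + r - s) / eps = L by rewrite /r; field; rewrite gt_eqF.
  have -> : (s - r - s) / eps = - L by rewrite /r; field; rewrite gt_eqF.
  by rewrite atanN opprK mulr_natl mulr2n.
have : \int[mu]_(t in E) poisson eps (s - t) <= pi.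
  by apply: int_poisson_lepi => //; lra.
by move=> h1 h2; rewrite lerBrDl -h2.
Qed.

(** The oscillation of [g] is estimated on balls of radius [L / n.+1]: first [L]
    is taken so large that the tails of the kernel are negligible, and then the
    mean oscillation on these shrinking balls tends to 0. *)
Lemma poisson_lebesgue_pt (g : R -> R) (M s a b : R) :
  measurable_fun setT g -> (forall t : R, `|g t| <= M) ->
  a < s -> s < b -> lebesgue_pt g s ->
  \int[mu]_(t in `[a, b]) (g t * poisson n.+1%:R^-1 (s - t)) @[n --> \oo]
    --> pi * g s.
Proof.
move=> mg gM as_ sb ls.
have M0 : 0 <= M by apply: le_trans (gM 0).
have ab : a < b by lra.
pose W (n : nat) := \int[mu]_(t in `[a, b]) poisson n.+1%:R^-1 (s - t).
pose O (n : nat) := \int[mu]_(t in `[a, b]) (`|g t - g s| * poisson n.+1%:R^-1 (s - t)).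
have ie (n : nat) : 0 < n.+1%:R^-1 :> R by rewrite invr_gt0.
have cW : W n @[n --> \oo] --> pi.
  have c (c : R) : 0 < c -> atan (c * n.+1%:R) @[n --> \oo] --> pi / 2.
    move=> c0; have h : (n.+1%:R : R) @[n --> \oo] --> +oo.
      by rewrite (cvg_shiftS (fun n => n%:R : R)); exact: cvgr_idn.
    exact: (cvg_comp _ _ h (cvgy_atan_mull c0)).
  have bs0 : 0 < b - s by lra.
  have sa0 : 0 < s - a by lra.
  have -> : pi = pi / 2 + pi / 2 :> R by lra.
  have -> : W = (fun n => atan ((b - s) * n.+1%:R) + atan ((s - a) * n.+1%:R)).
    apply/funext => n; rewrite /W /Rintegral int_poisson_itv//= invrK.
    by rewrite -(opprB s a) mulNr atanN opprK.
  exact: cvgD (c _ bs0) (c _ sa0).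
have ig n : mu.-integrable `[a, b]
    (EFin \o (fun t => g t * poisson n.+1%:R^-1 (s - t))).
  apply: (@integrable_le_norm R _ _ (fun t => M * poisson n.+1%:R^-1 (s - t))) => //.
  - by apply: measurable_funTS; apply: measurable_funM => //; exact: measurable_poisson.
  - move=> t _; rewrite normrM (ger0_norm (poisson_ge0 _ _))//.
    by rewrite ler_wpM2r// poisson_ge0.
  - by apply: integrable_scale => //; exact: integrable_poisson.
have diff n : `|\int[mu]_(t in `[a, b]) (g t * poisson n.+1%:R^-1 (s - t)) - g s * W n|
    <= O n.
  have iP := integrable_poisson s a b (ie n).
  have iZ := integrable_scale (g s) (measurable_itv _) iP.
  have iB := integrable_sub (measurable_itv _) (ig n) iZ.
  rewrite /W -(RintegralZl (mu := mu) _ _ iP)// -(RintegralB (mu := mu) _ (ig n) iZ)//.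
  apply: le_trans (le_normr_Rintegral _ iB) _ => //.
  by rewrite /O; under eq_Rintegral do
    rewrite -mulrBl normrM (ger0_norm (poisson_ge0 _ (ie n))).
have cO : O n @[n --> \oo] --> 0.
  apply/cvgrPdist_le => e e0.
  have [L L0 hL] : exists2 L, 0 < L & 2 * M * (pi - 2 * atan L) <= e / 2.
    pose d := e / 2 / (4 * (M + 1)).
    have d0 : 0 < d by rewrite !divr_gt0//; lra.
    have /cvgrPdist_le/(_ d d0) near_pi := @cvgy_atan R.
    near (+oo : set_system R) => L; exists L.
      by near: L; apply: nbhs_pinfty_gt; exact: num_real.
    have : `|pi / 2 - atan L| <= d by near: L.
    rewrite ger0_norm; last by rewrite subr_ge0 ltW// atan_ltpi2.
    move=> hd; have -> : 2 * M * (pi - 2 * atan L) = 4 * M * (pi / 2 - atan L) by lra.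
    have -> : e / 2 = d * (4 * (M + 1)) by rewrite /d; field; lra.
    have := atan_ltpi2 L; nra.
  have cr : L * n.+1%:R^-1 @[n --> \oo] --> (0 : R).
    by rewrite -(mulr0 L); apply: cvgMl_tmp; exact: cvg_harmonic.
  have rn n : 0 < L * n.+1%:R^-1 by rewrite mulr_gt0.
  have r0 : fine (davg g s (L * n.+1%:R^-1)) @[n --> \oo] --> (0 : R).
    by apply: fine_cvg; move/cvge_at_rightP : ls; exact.
  near=> n; rewrite sub0r normrN ger0_norm; last first.
    by apply: Rintegral_ge0 => t _; rewrite mulr_ge0 ?poisson_ge0.
  apply: (le_trans (poisson_oscillation (ie n) L0 mg gM _ _)).
  - rewrite ltrBrDl -ltrBrDr; near: n.
    by apply: cvgr_lt cr _ _; lra.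
  - rewrite -ltrBrDl; near: n.
    by apply: cvgr_lt cr _ _; lra.
  have -> : e = e / 2 + e / 2 by lra.
  apply: lerD => //.
  rewrite mulrC -ler_pdivlMr ?mulr_gt0//; near: n.
  by apply: cvgr_le r0 _ _; rewrite !divr_gt0 ?mulr_gt0.
have : \int[mu]_(t in `[a, b]) (g t * poisson n.+1%:R^-1 (s - t)) - g s * W n
    @[n --> \oo] --> 0.
  apply: norm_cvg0; apply: (@squeeze_cvgr _ _ _ _ (fun=> 0) _ _ _ _ _ cO).
    by apply: nearW => n; rewrite normr_ge0 /=; exact: diff.
  exact: cvg_cst.
have cgW : g s * W n @[n --> \oo] --> g s * pi by apply: cvgMl_tmp; exact: cW.
move=> c0; rewrite mulrC -[g s * pi]add0r.
rewrite (_ : (fun n => _) = fun n => (\int[mu]_(t in `[a, b])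
    (g t * poisson n.+1%:R^-1 (s - t)) - g s * W n) + g s * W n).
  exact: cvgD c0 cgW.
by apply/funext => n; rewrite subrK.
Unshelve. all: end_near. Qed.

Lemma poisson_approx (g : R -> R) (M a b : R) : a < b ->
  measurable_fun setT g -> (forall t : R, `|g t| <= M) ->
  {ae mu, forall s : R, `[a, b] s ->
    \int[mu]_(t in `[a, b]) (g t * poisson n.+1%:R^-1 (s - t)) @[n --> \oo]
      --> pi * g s}.
Proof.
move=> ab mg gM.
have nAB : {ae mu, forall s : R, `[a, b] s -> a < s < b}.
  have : mu.-negligible [set a; b].
    by apply: negligibleU; apply/negligibleP => //; exact: lebesgue_measure_set1.
  apply: negligibleS => s /= /not_implyP[]; rewrite in_itv/= => /andP[sa sb] h.
  apply: contrapT => /not_orP[/eqP sna /eqP snb]; apply: h.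
  by rewrite !lt_neqAle sa sb eq_sym sna snb.
have ls : {ae mu, forall s : R, lebesgue_pt g s}.
  apply: lebesgue_differentiation; split => //; first exact: openT.
  move=> K _ cK; have /integrableP[] : mu.-integrable K (EFin \o g).
    apply: measurable_bounded_integrable.
    - exact: compact_measurable.
    - by apply: compact_finite_measure.
    - exact: measurable_funTS.
    - exists M; split; first exact: num_real.
      by move=> N MN t _ /=; rewrite (le_trans (gM t))// ltW.
  by [].
apply: ae_imply2 nAB ls => s h lsg sE.
by have /andP[as_ sb] := h sE; exact: (poisson_lebesgue_pt mg gM as_ sb lsg).
Qed.

(** Dominated convergence: the Poisson kernel has mass at most [pi], so that the
    inner integral is at most [M * pi]. *)
Lemma cvg_poisson_form (f g : R -> R) (M a b : R) : a < b ->
  measurable_fun setT f -> mu.-integrable `[a, b] (EFin \o f) ->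
  measurable_fun setT g -> (forall t : R, `|g t| <= M) ->
  \int[mu]_(s in `[a, b]) (f s *
     \int[mu]_(t in `[a, b]) (g t * poisson n.+1%:R^-1 (s - t))) @[n --> \oo]
  --> \int[mu]_(s in `[a, b]) (f s * (pi * g s)).
Proof.
move=> ab mf jf mg gM.
have M0 : 0 <= M by apply: le_trans (gM 0).
have ig n s : mu.-integrable `[a, b]
    (EFin \o (fun t => g t * poisson n.+1%:R^-1 (s - t))).
  apply: (@integrable_le_norm R _ _ (fun t => M * poisson n.+1%:R^-1 (s - t))) => //.
  - by apply: measurable_funTS; apply: measurable_funM => //; exact: measurable_poisson.
  - move=> t _; rewrite normrM (ger0_norm (poisson_ge0 _ _))//.
    by rewrite ler_wpM2r// poisson_ge0.
  - by apply: integrable_scale => //; exact: integrable_poisson.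
apply: (Rintegral_dominated_cvg (g := fun s => `|f s| * (M * pi))) => //.
- move=> n; apply: measurable_funTS; apply: measurable_funM => //.
  apply: (measurable_Rintegral (h := fun p => g p.2 * poisson n.+1%:R^-1 (p.1 - p.2))) => //.
  by apply: measurable_funM; [exact: measurableT_comp|exact: measurable_poisson2].
- by apply: measurable_funTS; apply: measurable_funM => //; exact: measurable_funM.
- have := @integrable_scale R `[a, b] (M * pi) (fun s => `|f s|) (measurable_itv _)
    (integrable_norm jf).
  by congr (integrable _ _ _); apply/funext => s /=; rewrite mulrC.
- move=> n s _; rewrite normrM ler_wpM2l//.
  apply: le_trans (le_normr_Rintegral _ _) _ => //.
  apply: (@le_trans _ _ (\int[mu]_(t in `[a, b]) (M * poisson n.+1%:R^-1 (s - t)))).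
    apply: le_Rintegral => //.
    + exact/integrable_norm.
    + by apply: integrable_scale => //; exact: integrable_poisson.
    + move=> t _; rewrite normrM (ger0_norm (poisson_ge0 _ _))//.
      by rewrite ler_wpM2r// poisson_ge0.
  rewrite RintegralZl//; last exact: integrable_poisson.
  by rewrite ler_wpM2l// int_poisson_lepi.
- apply: ae_imply (poisson_approx ab mg gM) => s h abs.
  by apply: cvgMl_tmp; exact: h.
Qed.

End PoissonKernel.

(** * Forms of Gram kernels *)

Section Forms.
Context {R : realType}.
Local Open Scope classical_set_scope.
Local Notation mu := (@lebesgue_measure R).
Implicit Types (E : set R) (k l : R * R -> R) (f g c : R -> R).

Definition transform E k f (x : R) : R := \int[mu]_(t in E) (k (x, t) * f t).

Definition gram (eps : R) k l (s t : R) : R :=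
  \int[mu]_(x in Rp) (expR (- eps * x) * (k (x, s) * l (x, t))).

Lemma measurable_transform E k f : measurable E ->
  measurable_fun setT k -> measurable_fun setT f ->
  measurable_fun setT (transform E k f).
Proof.
move=> mE mk mf; apply: (measurable_Rintegral (h := fun p => k p * f p.2)) => //.
by apply: measurable_funM => //; exact: measurableT_comp.
Qed.

Lemma measurable_gram (eps : R) k l (s : R) : measurable_fun setT k -> measurable_fun setT l ->
  measurable_fun setT (gram eps k l s).
Proof.
move=> mk ml; apply: (measurable_Rintegral
  (h := fun p => expR (- eps * p.2) * (k (p.2, s) * l (p.2, p.1)))) => //.
have m2 : measurable_fun setT (snd : R * R -> R) by exact: measurable_snd.
apply: measurable_funM.
  by apply: measurableT_comp => //; exact: measurable_funM.
apply: measurable_funM.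
  exact: (measurableT_comp (measurableT_comp mk (measurable_pair2 s)) m2).
by apply: measurableT_comp => //; exact: measurable_swap.
Qed.

Lemma integrable_subset (E D : set R) f : measurable E -> measurable D ->
  D `<=` E -> mu.-integrable E (EFin \o f) -> mu.-integrable D (EFin \o f).
Proof. by move=> mE mD DE; apply: integrableS. Qed.

Section bounded.
Variables (E : set R) (eps : R).
Hypotheses (mE : measurable E) (e0 : 0 < eps).

Lemma integrable_kernel_mul (b : R -> R) f (C : R) : measurable_fun setT b ->
  measurable_fun setT f -> mu.-integrable E (EFin \o f) ->
  (forall t : R, E t -> `|b t| <= C) ->
  mu.-integrable E (EFin \o (fun t => b t * f t)).
Proof.
move=> mb mf jf bC; apply: (@integrable_le_norm R E _ (fun t => C * `|f t|)) => //.
- by apply: measurable_funTS; exact: measurable_funM.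
- by move=> t Et; rewrite normrM ler_wpM2r// bC.
- exact: (@integrable_scale R E C (fun t => `|f t|) mE (integrable_norm jf)).
Qed.

Lemma norm_Rintegral_mul_le (b : R -> R) f (C : R) : measurable_fun setT b ->
  measurable_fun setT f -> mu.-integrable E (EFin \o f) ->
  (forall t : R, E t -> `|b t| <= C) ->
  `|\int[mu]_(t in E) (b t * f t)| <= C * \int[mu]_(t in E) `|f t|.
Proof.
move=> mb mf jf bC; have ibf := integrable_kernel_mul mb mf jf bC.
apply: (le_trans (le_normr_Rintegral (mu := mu) mE ibf)).
have jn := integrable_norm jf.
rewrite -(RintegralZl (mu := mu) _ mE jn); apply: le_Rintegral => //.
- exact: (integrable_norm ibf).
- exact: integrable_scale.
- by move=> t Et; rewrite normrM ler_wpM2r// bC.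
Qed.

Lemma norm_transform_le k f (C x : R) : measurable_fun setT k ->
  measurable_fun setT f -> mu.-integrable E (EFin \o f) ->
  (forall x t : R, 0 < x -> E t -> `|k (x, t)| <= C) -> 0 < x ->
  `|transform E k f x| <= C * \int[mu]_(t in E) `|f t|.
Proof.
move=> mk mf jf kC x0; apply: norm_Rintegral_mul_le => //.
- exact: measurable_section.
- by move=> t; exact: kC.
Qed.

(** Fubini applies because the weight makes bounded functions of [x] integrable. *)
Lemma swap_transform c l g (B C : R) : measurable_fun setT c ->
  measurable_fun setT l -> measurable_fun setT g -> mu.-integrable E (EFin \o g) ->
  (forall x : R, 0 < x -> `|c x| <= B) ->
  (forall x t : R, 0 < x -> E t -> `|l (x, t)| <= C) ->
  \int[mu]_(x in Rp) (expR (- eps * x) * (c x * transform E l g x)) =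
  \int[mu]_(t in E) (g t * \int[mu]_(x in Rp) (expR (- eps * x) * (c x * l (x, t)))).
Proof.
move=> mc ml mg jg cB lC.
pose h (p : R * R) := expR (- eps * p.1) * (c p.1 * (l p * g p.2)).
have m1 : measurable_fun setT (fst : R * R -> R) by exact: measurable_fst.
have m2 : measurable_fun setT (snd : R * R -> R) by exact: measurable_snd.
have mw : measurable_fun setT (fun p : R * R => expR (- eps * p.1)).
  by apply: measurableT_comp => //; exact: measurable_funM.
have mh : measurable_fun setT h.
  apply: measurable_funM => //; apply: measurable_funM.
    exact: measurableT_comp.
  by apply: measurable_funM => //; exact: measurableT_comp.
transitivity (\int[mu]_(x in Rp) \int[mu]_(t in E) h (x, t)).
  apply: eq_Rintegral => x; rewrite inE RpE => x0.
  have il := integrable_kernel_mul (measurable_section x ml) mg jg (fun t => lC x t x0).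
  have ic := integrable_scale (c x) mE il.
  by rewrite /transform -(RintegralZl (mu := mu) _ mE il) -(RintegralZl (mu := mu) _ mE ic).
rewrite (@Rintegral_swap R Rp E (fun x => expR (- eps * x) * (B * C)) (fun t => `|g t|))//.
- apply: eq_Rintegral => t; rewrite inE => Et.
  have i : mu.-integrable Rp (EFin \o (fun x => expR (- eps * x) * (c x * l (x, t)))).
    apply: (@integrable_expR_bounded _ _ (B * C)) => //.
      apply: measurable_funM => //.
      exact: (measurableT_comp ml (measurable_pair2 t)).
    by move=> x x0; rewrite normrM ler_pM// ?cB ?lC.
  rewrite -(RintegralZl (mu := mu) _ measurable_Rp i); apply: eq_Rintegral => x _.
  by rewrite /h; ring.
- by apply: (@integrable_expR_bounded _ _ `|B * C|).
- exact: (integrable_norm jg).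
- move=> x t; rewrite RpE => x0 Et; rewrite /h !normrM ger0_norm ?expR_ge0//.
  rewrite -!mulrA ler_wpM2l ?expR_ge0// mulrA mulrA ler_wpM2r//.
  by rewrite ler_pM// ?cB ?lC.
Qed.

(** Exchanging the integrals once for each factor. *)
Lemma gram_form k l f g (B C : R) :
  measurable_fun setT k -> measurable_fun setT l ->
  measurable_fun setT f -> mu.-integrable E (EFin \o f) ->
  measurable_fun setT g -> mu.-integrable E (EFin \o g) ->
  (forall x t : R, 0 < x -> E t -> `|k (x, t)| <= B) ->
  (forall x t : R, 0 < x -> E t -> `|l (x, t)| <= C) ->
  \int[mu]_(x in Rp) (expR (- eps * x) * (transform E k f x * transform E l g x)) =
  \int[mu]_(s in E) (f s * \int[mu]_(t in E) (g t * gram eps k l s t)).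
Proof.
move=> mk ml mf jf mg jg kB lC.
under eq_Rintegral do rewrite [X in _ * X]mulrC.
have mT := measurable_transform mE ml mg.
rewrite (swap_transform mT mk mf jf (fun x x0 => norm_transform_le ml mg jg lC x0) kB).
apply: eq_Rintegral => s; rewrite inE => Es; congr (_ * _).
under eq_Rintegral do rewrite [X in _ * X]mulrC.
have mks := measurableT_comp mk (measurable_pair2 s).
by rewrite (swap_transform mks ml mg jg (fun x x0 => kB x s x0 Es) lC).
Qed.

(** The inner integral is bounded and measurable in [s], being a weighted
    integral of [k (x, s)] against a fixed function of [x]. *)
Lemma integrable_gram_form k l f g (B C : R) :
  measurable_fun setT k -> measurable_fun setT l ->
  measurable_fun setT f -> mu.-integrable E (EFin \o f) ->
  measurable_fun setT g -> mu.-integrable E (EFin \o g) ->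
  (forall x t : R, 0 < x -> E t -> `|k (x, t)| <= B) ->
  (forall x t : R, 0 < x -> E t -> `|l (x, t)| <= C) ->
  mu.-integrable E (EFin \o (fun s => f s * \int[mu]_(t in E) (g t * gram eps k l s t))).
Proof.
move=> mk ml mf jf mg jg kB lC.
pose A := C * \int[mu]_(t in E) `|g t|.
have mT := measurable_transform mE ml mg.
have TA x : 0 < x -> `|transform E l g x| <= A by move=> x0; exact: norm_transform_le.
pose h (p : R * R) := f p.1 * (expR (- eps * p.2) * (k (p.2, p.1) * transform E l g p.2)).
have m1 : measurable_fun setT (fst : R * R -> R) by exact: measurable_fst.
have m2 : measurable_fun setT (snd : R * R -> R) by exact: measurable_snd.
have mh : measurable_fun setT h.
  apply: measurable_funM; first exact: measurableT_comp.
  apply: measurable_funM.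
    by apply: measurableT_comp => //; exact: measurable_funM.
  apply: measurable_funM; last exact: measurableT_comp.
  by apply: measurableT_comp => //; exact: measurable_swap.
have := @integrable_Rintegral R E Rp (fun s => `|f s|)
  (fun x => expR (- eps * x) * (B * A)) h mE measurable_Rp (integrable_norm jf).
move=> /(_ (integrable_expR_bounded (C := `|B * A|) e0 _ _) mh) H.
have {H} : mu.-integrable E (fun s => (\int[mu]_(x in Rp) h (s, x))%:E).
  apply: H => // s x Es; rewrite RpE => x0.
  rewrite /h !normrM ler_wpM2l// ger0_norm ?expR_ge0// ler_wpM2l ?expR_ge0//.
  by rewrite ler_pM// ?kB ?TA.
apply: eq_integrable => // s; rewrite inE => Es; congr EFin.
have mks := measurableT_comp mk (measurable_pair2 s).
have i : mu.-integrable Rp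
    (EFin \o (fun x => expR (- eps * x) * (k (x, s) * transform E l g x))).
  apply: (@integrable_expR_bounded _ _ (B * A)) => //.
    exact: measurable_funM.
  by move=> x x0; rewrite normrM ler_pM// ?kB ?TA.
rewrite /h -(swap_transform mks ml mg jg (fun x x0 => kB x s x0 Es) lC).
by rewrite -(RintegralZl (mu := mu) _ measurable_Rp i).
Qed.

Lemma integrable_gram_mul k l g (s B C : R) :
  measurable_fun setT k -> measurable_fun setT l ->
  measurable_fun setT g -> mu.-integrable E (EFin \o g) ->
  (forall x t : R, 0 < x -> E t -> `|k (x, t)| <= B) ->
  (forall x t : R, 0 < x -> E t -> `|l (x, t)| <= C) -> E s ->
  mu.-integrable E (EFin \o (fun t => g t * gram eps k l s t)).
Proof.
move=> mk ml mg jg kB lC Es.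
have H : mu.-integrable E (EFin \o (fun t => gram eps k l s t * g t)).
  apply: (@integrable_kernel_mul _ _ (\int[mu]_(x in Rp) (expR (- eps * x) * `|B * C|))) => //.
    exact: measurable_gram.
  move=> t Et; apply: (le_trans (le_normr_Rintegral _ _)) => //.
    apply: (@integrable_expR_bounded _ _ (B * C)) => //.
      apply: measurable_funM; first exact: (measurableT_comp mk (measurable_pair2 s)).
      exact: (measurableT_comp ml (measurable_pair2 t)).
    by move=> x x0; rewrite normrM ler_pM// ?kB ?lC.
  apply: le_Rintegral => //.
  - apply: integrable_norm; apply: (@integrable_expR_bounded _ _ (B * C)) => //.
      apply: measurable_funM; first exact: (measurableT_comp mk (measurable_pair2 s)).
      exact: (measurableT_comp ml (measurable_pair2 t)).
    by move=> x x0; rewrite normrM ler_pM// ?kB ?lC.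
  - by apply: (@integrable_expR_bounded _ _ `|B * C|) => //; move=> x _; rewrite normr_id.
  - move=> x; rewrite RpE => x0; rewrite normrM ger0_norm ?expR_ge0// ler_wpM2l ?expR_ge0//.
    by rewrite (le_trans _ (ler_norm _))// normrM ler_pM// ?kB ?lC.
by move: H; congr (integrable _ _ _); apply/funext => t /=; rewrite mulrC.
Qed.

End bounded.
End Forms.

(** * The lower bound for the energy of the transform *)

Section KeyInequality.
Context {R : realType}.
Local Open Scope classical_set_scope.
Local Notation mu := (@lebesgue_measure R).
Implicit Types (E : set R) (f g : R -> R).

Definition mul_kernel (k : R -> R) (p : R * R) : R := k (p.1 * p.2).

Lemma measurable_mul_kernel (k : R -> R) : measurable_fun setT k ->
  measurable_fun setT (mul_kernel k).
Proof. by move=> mk; apply: measurableT_comp => //; exact: measurable_funM. Qed.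

Let mcos : measurable_fun setT (mul_kernel (@cos R)).
Proof.
apply: measurable_mul_kernel; apply: continuous_measurable_fun => x.
by apply: is_derive_continuous; der.
Qed.

Let msin : measurable_fun setT (mul_kernel (@sin R)).
Proof.
apply: measurable_mul_kernel; apply: continuous_measurable_fun => x.
by apply: is_derive_continuous; der.
Qed.

Let expN (x : R) := expR (- x).

Let mexp : measurable_fun setT (mul_kernel expN).
Proof. by apply: measurable_mul_kernel; exact: measurableT_comp. Qed.

Let mK : measurable_fun setT (mul_kernel (@explicit_kernel R)).
Proof. by apply: measurable_mul_kernel; exact: measurable_explicit_kernel. Qed.

Let cos1 E (x t : R) : 0 < x -> E t -> `|mul_kernel (@cos R) (x, t)| <= 1.
Proof. by move=> _ _; rewrite ler_norml cos_geN1 cos_le1. Qed.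

Let sin1 E (x t : R) : 0 < x -> E t -> `|mul_kernel (@sin R) (x, t)| <= 1.
Proof. by move=> _ _; rewrite ler_norml sin_geN1 sin_le1. Qed.

Lemma explicit_kernel_norm_le (z : R) : 0 <= z -> `|explicit_kernel z| <= 3.
Proof.
move=> z0; have pi0 := @pi_gt0 R; have := aux0_le z0; have := aux_ge0 0 z.
have : 2 / pi * aux 0 z <= 2 / pi * (pi / 2) -> 2 / pi * aux 0 z <= 1.
  by rewrite mulrA divfK ?gt_eqF// divff ?pnatr_eq0.
move=> h h1 h2; have {h}h3 := h (ler_wpM2l (ltW (divr_gt0 (@ltr0Sn R 1) pi0)) h2).
have {h1} h4 : 0 <= 2 / pi * aux 0 z by rewrite mulr_ge0// divr_ge0// ltW.
rewrite /explicit_kernel; move: (2 / pi * _) h3 h4 => q q1 q0.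
have := (cos_geN1 z, cos_le1 z, sin_geN1 z, sin_le1 z) => -[[[c0 c1] s0] s1].
by rewrite ler_norml; apply/andP; split; lra.
Qed.

Section segment.
Variables (a b : R).
Hypotheses (a0 : 0 < a) (ab : a < b).
Let E : set R := `[a, b].
Let mE : measurable E. Proof. exact: measurable_itv. Qed.

Let E_gt0 t : E t -> 0 < t.
Proof. by rewrite /E /= in_itv/= => /andP[at_ _]; exact: lt_le_trans at_. Qed.

Let K3 (x t : R) : 0 < x -> E t -> `|mul_kernel (@explicit_kernel R) (x, t)| <= 3.
Proof. by move=> x0 /E_gt0 t0; apply: explicit_kernel_norm_le; rewrite mulr_ge0// ltW. Qed.

Let exp1 (x t : R) : 0 < x -> E t -> `|mul_kernel expN (x, t)| <= 1.
Proof.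
move=> x0 /E_gt0 t0; rewrite ger0_norm ?expR_ge0// -expR0 ler_expR/=.
by rewrite oppr_le0 mulr_ge0// ltW.
Qed.

Let cos1E := cos1 (E := E).
Let sin1E := sin1 (E := E).

Section damped.
Variable eps : R.
Hypothesis e0 : 0 < eps.

Let integrable_bounded (h : R -> R) (C : R) := integrable_expR_bounded (f := h) (C := C) e0.

Lemma gram_cos_sin s t :
  gram eps (mul_kernel (@cos R)) (mul_kernel (@cos R)) s t +
  gram eps (mul_kernel (@sin R)) (mul_kernel (@sin R)) s t = poisson eps (s - t).
Proof.
rewrite /gram -RintegralD//; last 2 first.
- apply: (integrable_bounded (C := 1)).
    by apply: measurable_funM; exact: measurable_cosM.
  by move=> x x0; rewrite normrM mulr_ile1// ler_norml cos_geN1 cos_le1.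
- apply: (integrable_bounded (C := 1)).
    by apply: measurable_funM; exact: measurable_sinM.
  by move=> x x0; rewrite normrM mulr_ile1// ler_norml sin_geN1 sin_le1.
rewrite /poisson -(int_expR_cos (s - t) e0); apply: eq_Rintegral => x _.
by rewrite -mulrDr /mul_kernel/= mulrBl -cosB (mulrC s) (mulrC t).
Qed.

Lemma gram_exp s t : 0 < s -> 0 < t ->
  gram eps (mul_kernel expN) (mul_kernel expN) s t = (eps + s + t)^-1.
Proof.
move=> s0 t0; have p0 : 0 < eps + s + t by rewrite !addr_gt0.
rewrite /gram -[RHS]/(fine _%:E) -(int_expR p0) /Rintegral; congr fine.
apply: eq_integral => x _; rewrite /mul_kernel /expN/= -!expRD; congr (expR _)%:E.
by ring.
Qed.

Section two.
Variables (f g : R -> R).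
Hypotheses (mf : measurable_fun setT f) (mg : measurable_fun setT g).
Hypotheses (jf : mu.-integrable E (EFin \o f)) (jg : mu.-integrable E (EFin \o g)).

Local Notation Cos := (transform E (mul_kernel (@cos R))).
Local Notation Sin := (transform E (mul_kernel (@sin R))).

Lemma poisson_section s : E s ->
  \int[mu]_(t in E) (g t * poisson eps (s - t)) =
  \int[mu]_(t in E) (g t * gram eps (mul_kernel (@cos R)) (mul_kernel (@cos R)) s t) +
  \int[mu]_(t in E) (g t * gram eps (mul_kernel (@sin R)) (mul_kernel (@sin R)) s t).
Proof.
move=> Es.
have ic := integrable_gram_mul mE e0 mcos mcos mg jg cos1E cos1E Es.
have is_ := integrable_gram_mul mE e0 msin msin mg jg sin1E sin1E Es.
rewrite -(RintegralD (mu := mu) mE ic is_); apply: eq_Rintegral => t _.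
by rewrite -mulrDr gram_cos_sin.
Qed.

Let ifc := integrable_gram_form mE e0 mcos mcos mf jf mg jg cos1E cos1E.
Let ifs := integrable_gram_form mE e0 msin msin mf jf mg jg sin1E sin1E.

Lemma integrable_poisson_form : mu.-integrable E
  (EFin \o (fun s => f s * \int[mu]_(t in E) (g t * poisson eps (s - t)))).
Proof.
have := integrable_add mE ifc ifs; apply: eq_integrable => // s; rewrite inE => Es.
by rewrite /= poisson_section// mulrDr.
Qed.

Lemma integrable_CosSin : 
  mu.-integrable Rp (EFin \o (fun x => expR (- eps * x) * (Cos f x * Cos g x))) /\
  mu.-integrable Rp (EFin \o (fun x => expR (- eps * x) * (Sin f x * Sin g x))).
Proof.
split; apply: (integrable_bounded (C := (1 * \int[mu]_(t in E) `|f t|) *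
    (1 * \int[mu]_(t in E) `|g t|))).
- by apply: measurable_funM; exact: measurable_transform.
- by move=> x x0; rewrite normrM; apply: ler_pM => //; exact: norm_transform_le.
- by apply: measurable_funM; exact: measurable_transform.
- by move=> x x0; rewrite normrM; apply: ler_pM => //; exact: norm_transform_le.
Qed.

(** The Poisson kernel is a sum of two Gram kernels, since
    [cos (x * (s - t))] is the sum of the products of cosines and of sines. *)
Lemma poisson_form :
  \int[mu]_(s in E) (f s * \int[mu]_(t in E) (g t * poisson eps (s - t))) =
  \int[mu]_(x in Rp) (expR (- eps * x) * (Cos f x * Cos g x + Sin f x * Sin g x)).
Proof.
have [iC iS] := integrable_CosSin.
under [RHS]eq_Rintegral do rewrite mulrDr.
rewrite (RintegralD (mu := mu) measurable_Rp iC iS).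
rewrite (gram_form mE e0 mcos mcos mf jf mg jg cos1E cos1E).
rewrite (gram_form mE e0 msin msin mf jf mg jg sin1E sin1E).
rewrite -(RintegralD (mu := mu) mE ifc ifs); apply: eq_Rintegral => s.
by rewrite inE => Es; rewrite poisson_section// mulrDr.
Qed.

End two.

Lemma integrable_CosSinD f g :
  measurable_fun setT f -> measurable_fun setT g ->
  mu.-integrable E (EFin \o f) -> mu.-integrable E (EFin \o g) ->
  mu.-integrable Rp (EFin \o (fun x => expR (- eps * x) *
    (transform E (mul_kernel (@cos R)) f x * transform E (mul_kernel (@cos R)) g x +
     transform E (mul_kernel (@sin R)) f x * transform E (mul_kernel (@sin R)) g x))).
Proof.
move=> mf mg jf jg; have [iC iS] := integrable_CosSin mf mg jf jg.
have := integrable_add measurable_Rp iC iS; congr (integrable _ _ _).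
by apply/funext => x /=; rewrite mulrDr.
Qed.

(** The form is positive at [f - g]. This trades one of the two functions [f],
    which is only integrable, for the function [g], which will be bounded. *)
Lemma poisson_form_ge f g :
  measurable_fun setT f -> measurable_fun setT g ->
  mu.-integrable E (EFin \o f) -> mu.-integrable E (EFin \o g) ->
  2 * \int[mu]_(s in E) (f s * \int[mu]_(t in E) (g t * poisson eps (s - t))) -
  \int[mu]_(s in E) (g s * \int[mu]_(t in E) (g t * poisson eps (s - t))) <=
  \int[mu]_(s in E) (f s * \int[mu]_(t in E) (f t * poisson eps (s - t))).
Proof.
move=> mf mg jf jg; rewrite !poisson_form//.
have ifg := integrable_CosSinD mf mg jf jg.
have igg := integrable_CosSinD mg mg jg jg.
have iff := integrable_CosSinD mf mf jf jf.
have i2 := integrable_scale 2 measurable_Rp ifg.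
rewrite -(RintegralZl (mu := mu) _ measurable_Rp ifg).
rewrite -(RintegralB (mu := mu) measurable_Rp i2 igg).
apply: le_Rintegral => //; first exact: integrable_sub.
move=> x _ /=; move: (transform _ _ f x) (transform _ _ g x) (expR_ge0 (- eps * x)).
move: (transform _ _ f x) (transform _ _ g x) (expR _) => p q w c d w0.
rewrite mulrCA -mulrBr ler_wpM2l// -subr_ge0.
rewrite (_ : _ - _ = (c - d) ^+ 2 + (p - q) ^+ 2); last by ring.
by rewrite addr_ge0 ?sqr_ge0.
Qed.

Lemma stieltjes_form_ge0 f : measurable_fun setT f -> mu.-integrable E (EFin \o f) ->
  0 <= \int[mu]_(s in E) (f s * \int[mu]_(t in E)
    (f t * gram eps (mul_kernel expN) (mul_kernel expN) s t)).
Proof.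
move=> mf jf; rewrite -(gram_form mE e0 mexp mexp mf jf mf jf exp1 exp1).
by apply: Rintegral_ge0 => x _; rewrite mulr_ge0 ?expR_ge0// -expr2 sqr_ge0.
Qed.

Lemma form_algebra (A P S c : R) : 0 <= S -> `|A - P - S| <= c -> P - c <= A.
Proof. by rewrite ler_norml => S0 /andP[h _]; lra. Qed.

(** The estimate [d] of the Gram kernel fails on the diagonal, which is negligible
    in every section; the Stieltjes part of the kernel has a nonnegative form. *)
Lemma damped_form_ge f (d : R) : measurable_fun setT f -> mu.-integrable E (EFin \o f) ->
  (forall s t : R, E s -> E t -> s != t ->
    `|damped_gram eps s t - (poisson eps (s - t) + (eps + s + t)^-1)| <= d) ->
  \int[mu]_(s in E) (f s * \int[mu]_(t in E) (f t * poisson eps (s - t))) -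
    d * (\int[mu]_(t in E) `|f t|) ^+ 2 <=
  \int[mu]_(x in Rp) (expR (- eps * x) * transform E (mul_kernel (@explicit_kernel R)) f x ^+ 2).
Proof.
move=> mf jf Hd.
have jn := integrable_norm jf.
set N := \int[mu]_(t in E) `|f t|.
under [leRHS]eq_Rintegral do rewrite expr2.
rewrite (gram_form mE e0 mK mK mf jf mf jf K3 K3).
have i1 := integrable_gram_form mE e0 mK mK mf jf mf jf K3 K3.
have i2 := integrable_poisson_form mf mf jf jf.
have i3 := integrable_gram_form mE e0 mexp mexp mf jf mf jf exp1 exp1.
have section s : E s -> `|\int[mu]_(t in E) (f t * gram eps (mul_kernel (@explicit_kernel R))
      (mul_kernel (@explicit_kernel R)) s t) - \int[mu]_(t in E) (f t * poisson eps (s - t)) -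
    \int[mu]_(t in E) (f t * gram eps (mul_kernel expN) (mul_kernel expN) s t)| <= d * N.
  move=> Es.
  have j1 := integrable_gram_mul mE e0 mK mK mf jf K3 K3 Es.
  have j2 : mu.-integrable E (EFin \o (fun t => f t * poisson eps (s - t))).
    have ic := integrable_gram_mul mE e0 mcos mcos mf jf cos1E cos1E Es.
    have is_ := integrable_gram_mul mE e0 msin msin mf jf sin1E sin1E Es.
    have := integrable_add mE ic is_; congr (integrable _ _ _).
    by apply/funext => t /=; rewrite -mulrDr gram_cos_sin.
  have j3 := integrable_gram_mul mE e0 mexp mexp mf jf exp1 exp1 Es.
  have j12 := integrable_sub mE j1 j2; have j := integrable_sub mE j12 j3.
  rewrite -(RintegralB (mu := mu) mE j1 j2) -(RintegralB (mu := mu) mE j12 j3).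
  apply: (le_trans (le_normr_Rintegral (mu := mu) mE j)).
  have mE1 : measurable (E `\ s) by exact: measurableD.
  have drop (h : R -> R) : measurable_fun setT h ->
      \int[mu]_(t in E) h t = \int[mu]_(t in E `\ s) h t.
    move=> mh; rewrite /Rintegral integral_setD1//.
    by apply: measurable_funTS; exact/measurable_EFinP.
  have jd := integrable_scale d mE jn.
  have mP : measurable_fun setT (fun t => f t * poisson eps (s - t)).
    by apply: measurable_funM => //; exact: measurable_poisson.
  rewrite -(RintegralZl (mu := mu) _ mE jn) drop ?(drop (fun t => d * _)); last 2 first.
  - by apply: measurable_funM => //; exact: measurableT_comp.
  - apply: measurableT_comp => //; apply: measurable_funB; first apply: measurable_funB => //.
    + by apply: measurable_funM => //; exact: measurable_gram.
    + by apply: measurable_funM => //; exact: measurable_gram.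
  have sE : E `\ s `<=` E by exact: subDsetl.
  apply: le_Rintegral => //.
  + by apply: (integrable_subset mE mE1 sE); exact: (integrable_norm j).
  + by apply: (integrable_subset mE mE1 sE); exact: jd.
  move=> t [Et /eqP ts]; rewrite gram_exp ?E_gt0// -!mulrBr normrM mulrC ler_wpM2r//.
  by rewrite -addrA -opprD Hd// eq_sym.
have i12 := integrable_sub mE i1 i2.
have i123 := integrable_sub mE i12 i3.
have : `|\int[mu]_(s in E) (f s * \int[mu]_(t in E) (f t * gram eps (mul_kernel (@explicit_kernel R))
      (mul_kernel (@explicit_kernel R)) s t) - f s * \int[mu]_(t in E) (f t * poisson eps (s - t)) -
    f s * \int[mu]_(t in E) (f t * gram eps (mul_kernel expN) (mul_kernel expN) s t))|
    <= d * N ^+ 2.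
  apply: (le_trans (le_normr_Rintegral (mu := mu) mE i123)).
  rewrite expr2 mulrA -(RintegralZl (mu := mu) _ mE jn).
  apply: le_Rintegral => //.
  + exact: (integrable_norm i123).
  + exact: integrable_scale.
  + by move=> s Es; rewrite -!mulrBr normrM mulrC ler_wpM2r// section.
rewrite (RintegralB (mu := mu) mE i12 i3) (RintegralB (mu := mu) mE i1 i2).
exact: form_algebra (stieltjes_form_ge0 mf jf).
Qed.

End damped.

(** The condition on [g] says that it is a truncation of [f]. Then the forms of
    the Poisson kernel at [(f, g)] and at [(g, g)] have the same limit, and
    [2 * X - X = X] in the limit of [poisson_form_ge]. *)
Lemma transform_energy_ge f g (M : R) :
  measurable_fun setT f -> mu.-integrable E (EFin \o f) ->
  measurable_fun setT g -> (forall t : R, `|g t| <= M) ->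
  (forall t : R, f t * g t = g t ^+ 2) ->
  ((pi * \int[mu]_(t in E) g t ^+ 2)%:E <=
   \int[mu]_(x in Rp) (transform E (mul_kernel (@explicit_kernel R)) f x ^+ 2)%:E)%E.
Proof.
move=> mf jf mg gM fg.
have jg : mu.-integrable E (EFin \o g).
  apply: (@integrable_le_norm R _ _ (fun=> M)) => //; first exact: measurable_funTS.
  apply: continuous_compact_integrable; first exact: segment_compact.
  by apply: continuous_subspaceT => t; exact: cvg_cst.
have mT := measurable_transform mE mK mf.
set I := (\int[mu]_(x in Rp) _)%E.
pose d (n : nat) : R := 6 * n.+1%:R^-1 / a ^+ 2 + 4 / pi ^+ 2 * defect n.+1%:R^-1 a.
pose N := \int[mu]_(t in E) `|f t|.
pose Q (u v : R -> R) (n : nat) := \int[mu]_(s in E) (u s *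
  \int[mu]_(t in E) (v t * poisson n.+1%:R^-1 (s - t))).
pose A (n : nat) := \int[mu]_(x in Rp) (expR (- n.+1%:R^-1 * x) *
  transform E (mul_kernel (@explicit_kernel R)) f x ^+ 2).
have en (n : nat) : 0 < n.+1%:R^-1 :> R by rewrite invr_gt0.
have AI n : ((A n)%:E <= I)%E.
  have iA : mu.-integrable Rp (EFin \o (fun x => expR (- n.+1%:R^-1 * x) *
      transform E (mul_kernel (@explicit_kernel R)) f x ^+ 2)).
    apply: (@integrable_expR_bounded _ _ ((3 * N) ^+ 2)) => //.
      exact: measurable_funX.
    move=> x x0; rewrite normrX ler_sqr ?nnegrE//.
      exact: (norm_transform_le mE mK mf jf K3).
    by rewrite (le_trans _ (norm_transform_le mE mK mf jf K3 x0)).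
  rewrite /A /Rintegral fineK; last exact: integrable_fin_num.
  apply: ge0_le_integral => //.
  - by move=> x _; rewrite lee_fin mulr_ge0 ?expR_ge0 ?sqr_ge0.
  - exact: (measurable_int mu iA).
  - by apply/measurable_EFinP; apply: measurable_funTS; exact: measurable_funX.
  - move=> x; rewrite RpE => x0; rewrite lee_fin ler_piMl ?sqr_ge0//.
    by rewrite -expR0 ler_expR mulNr oppr_le0 mulr_ge0 ?(ltW x0) ?(ltW (en n)).
pose B (n : nat) := 2 * Q f g n - Q g g n - d n * N ^+ 2.
have BA n : B n <= A n.
  have P := poisson_form_ge (en n) mf mg jf jg.
  apply: (le_trans (lerB P (lexx _))); apply: damped_form_ge => // s t Es Et st.
  move: Es Et; rewrite /E /= !in_itv/= => /andP[as_ _] /andP[at_ _].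
  exact: damped_gram_approx.
have cd : d n @[n --> \oo] --> (0 : R).
  have -> : 0 = 6 * 0 / a ^+ 2 + 4 / pi ^+ 2 * 0 :> R by rewrite !(mul0r,mulr0) addr0.
  apply: cvgD; last by apply: cvgMl_tmp; exact: cvg_defect.
  by apply: cvgMr_tmp; apply: cvgMl_tmp; exact: cvg_harmonic.
have cB : B n @[n --> \oo] --> pi * \int[mu]_(t in E) g t ^+ 2.
  have ig2 : mu.-integrable E (EFin \o (fun t => g t ^+ 2)).
    apply: (@integrable_le_norm R _ _ (fun=> M ^+ 2)) => //.
    - by apply: measurable_funTS; exact: measurable_funX.
    - by move=> t _; rewrite normrX ler_sqr ?nnegrE// (le_trans _ (gM t)).
    - apply: continuous_compact_integrable; first exact: segment_compact.
      by apply: continuous_subspaceT => t; exact: cvg_cst.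
  have cfg : Q f g n @[n --> \oo] --> pi * \int[mu]_(t in E) g t ^+ 2.
    rewrite -(RintegralZl (mu := mu) _ mE ig2).
    under eq_Rintegral do rewrite -fg mulrCA.
    exact: (cvg_poisson_form ab mf jf mg gM).
  have cgg : Q g g n @[n --> \oo] --> pi * \int[mu]_(t in E) g t ^+ 2.
    rewrite -(RintegralZl (mu := mu) _ mE ig2).
    under eq_Rintegral do rewrite expr2 mulrCA.
    exact: (cvg_poisson_form ab mg jg mg gM).
  set L := pi * _ in cfg cgg *.
  have -> : L = 2 * L - L - 0 * N ^+ 2 by ring.
  apply: cvgB; last by apply: cvgMr_tmp; exact: cd.
  by apply: cvgB; [apply: cvgMl_tmp; exact: cfg|exact: cgg].
have [->|Ify] := eqVneq I +oo%E; first exact: leey.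
have Ifin : I \is a fin_num.
  rewrite ge0_fin_numE ?ltey//.
  by apply: integral_ge0 => x _; rewrite lee_fin sqr_ge0.
rewrite -(fineK Ifin) lee_fin.
apply: (cvgr_to_le cB); apply: nearW => n.
by rewrite -lee_fin fineK// (le_trans _ (AI n))// lee_fin.
Qed.

End segment.
End KeyInequality.

(** * The Lommel function *)

Section Lommel.
Context {R : realType}.
Local Open Scope classical_set_scope.
Implicit Types (u v w : R -> R).

(** The first order system equivalent to [v'' + v = 1 / z] on the half-line. *)
Definition oscillator v := exists v' : R -> R, forall z : R, 0 < z ->
  is_derive z 1 v (v' z) /\ is_derive z 1 v' (z^-1 - v z).

Lemma constant_of_derive0 (f : R -> R) (x y : R) :
  (forall z : R, 0 < z -> is_derive z 1 f 0) -> 0 < x -> 0 < y -> f x = f y.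
Proof.
move=> df; wlog xy : x y / x < y.
  move=> H x0 y0; have [xy|yx|->//] := ltgtP x y; first exact: H.
  by apply/esym; exact: H.
move=> x0 _; have dfz z : z \in `]x, y[%R -> is_derive z 1 f 0.
  by rewrite in_itv/= => /andP[xz _]; apply: df; exact: lt_trans xz.
have cf : {within `[x, y], continuous f}.
  apply: derivable_within_continuous => z; rewrite in_itv/= => /andP[xz _].
  by have [] := df z (lt_le_trans x0 xz).
by have [c _ /eqP] := MVT xy dfz cf; rewrite mul0r subr_eq0 => /eqP ->.
Qed.

(** The difference [h] satisfies [h'' + h = 0], so it is a combination of sine and
    cosine with constant coefficients [A] and [B]. It is thus periodic, and as it
    tends to 0 at infinity it vanishes. *)
Lemma oscillator_unique u v : oscillator u -> oscillator v ->
  z * u z @[z --> +oo] --> (1 : R) -> z * v z @[z --> +oo] --> (1 : R) ->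
  forall z : R, 0 < z -> u z = v z.
Proof.
move=> [u' du] [v' dv] cu cv z z0; apply/eqP; rewrite -subr_eq0; apply/eqP.
pose h (y : R) := u y - v y; pose h' (y : R) := u' y - v' y.
have dh (y : R) : 0 < y -> is_derive y 1 h (h' y).
  by move=> y0; have [hu _] := du y y0; have [hv _] := dv y y0; rewrite /h /h'; der.
have dh' (y : R) : 0 < y -> is_derive y 1 h' (- h y).
  move=> y0; have [_ hu] := du y y0; have [_ hv] := dv y y0.
  by rewrite /h /h'; deriv; ring.
pose A (y : R) := h y * cos y - h' y * sin y.
pose B (y : R) := h y * sin y + h' y * cos y.
have dA (y : R) : 0 < y -> is_derive y 1 A 0.
  move=> y0; have H1 := dh y y0; have H2 := dh' y y0.
  by rewrite /A; deriv; ring.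
have dB (y : R) : 0 < y -> is_derive y 1 B 0.
  move=> y0; have H1 := dh y y0; have H2 := dh' y y0.
  by rewrite /B; deriv; ring.
have hAB (y : R) : h y = A y * cos y + B y * sin y.
  by rewrite /A /B -[LHS]mulr1 -(cos2Dsin2 y); ring.
pose p (n : nat) := z + pi *+ 2 *+ n.
have pi0 := @pi_gt0 R.
have per n : h (p n) = h z.
  have pn0 : 0 < p n by rewrite ltr_wpDr// mulrn_wge0// mulrn_wge0// ltW.
  rewrite hAB (constant_of_derive0 dA pn0 z0) (constant_of_derive0 dB pn0 z0).
  by rewrite /p (periodicn (@cosD2pi R)) (periodicn (@sinD2pi R)) -hAB.
have cp : p n @[n --> \oo] --> +oo.
  apply/cvgryPge => B0; near=> n; rewrite /p.
  have : B0 <= n%:R * 1 by rewrite mulr1; near: n; exact: nbhs_infty_ger.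
  move=> /le_trans; apply; rewrite -[X in _ <= _ + X]mulr_natl.
  rewrite (@le_trans _ _ (n%:R * (pi *+ 2)))//; last by rewrite lerDr ltW.
  by rewrite ler_wpM2l// mulr2n; have := @pi_ge2 R; lra.
have ch : h y @[y --> +oo] --> (0 : R).
  have -> : 0 = 0 * (1 - 1) :> R by rewrite mul0r.
  have ci : (y : R)^-1 @[y --> +oo] --> (0 : R).
    by have := @cvgy_invD R 0; under eq_fun do rewrite add0r.
  apply: (cvg_trans _ (cvgM ci (cvgB cu cv))); apply: near_eq_cvg; near=> y.
  have y0 : 0 < y by near: y; apply: nbhs_pinfty_gt; exact: num_real.
  rewrite /h [LHS](_ : _ = y^-1 * (y * u y - y * v y))//.
  by rewrite -mulrBr mulKf// gt_eqF.
have c0 : h (p n) @[n --> \oo] --> (0 : R) by exact: (cvg_comp _ _ cp ch).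
have cz : h (p n) @[n --> \oo] --> h z.
  by apply: cvg_near_cst; apply: nearW => n; rewrite per.
by have := cvg_unique _ cz c0; apply.
Unshelve. all: end_near. Qed.

Local Notation root z := (Num.sqrt z).

(** Multiplying by [sqrt z] removes the first order term of Bessel's equation, and
    for [nu = 1 / 2] the term in [z^-2] disappears with it. *)
Lemma lommelS_oscillator w : is_lommelS (- 2^-1) 2^-1 w ->
  oscillator (fun z => root z * w z) /\
  z * (root z * w z) @[z --> +oo] --> (1 : R).
Proof.
move=> [dw ddw ode asy]; split.
  exists (fun z => (2 * root z)^-1 * w z + root z * derive1 w z) => z z0.
  have h1 : is_derive z 1 w (derive1 w z) by rewrite derive1E; exact: (DeriveDef (dw z z0) erefl).
  have h2 : is_derive z 1 (derive1 w) (derive1 (derive1 w) z).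
    by rewrite [X in is_derive _ _ _ X]derive1E; exact: (DeriveDef (ddw z z0) erefl).
  have s0 : 0 < root z by rewrite sqrtr_gt0.
  have zE : z = root z ^+ 2 by rewrite sqr_sqrtr// ltW.
  split; first by deriv; [exact: z0|ring].
  have := ode z z0; rewrite (_ : - 2^-1 + 1 = 2^-1); last by lra.
  rewrite powR12_sqrt ?(ltW z0)// => odez.
  deriv; [by rewrite mulf_neq0 ?gt_eqF|exact: z0|exact: z0|].
  have -> : derive1 (derive1 w) z = (root z - z * derive1 w z -
      (z ^+ 2 - 2^-1 ^+ 2) * w z) / z ^+ 2.
    by rewrite -odez; field; rewrite gt_eqF.
  move: (derive1 w z) (w z) => p q; move: s0 zE; move: (root z) => s s0 ->.
  by field; rewrite gt_eqF.
move: asy; apply: cvg_trans; apply: near_eq_cvg; near=> z.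
have z0 : 0 < z by near: z; apply: nbhs_pinfty_gt; exact: num_real.
have -> : - 2^-1 - 1 = - (2^-1 + 1) :> R by lra.
rewrite powRN invrK powRD ?(gt_eqF z0) ?implybT// powR12_sqrt ?(ltW z0)// powRr1 ?(ltW z0)//.
by ring.
Unshelve. all: end_near. Qed.

Lemma aux_oscillator : oscillator (@aux R 0).
Proof.
exists (fun z => - aux 1 z) => z z0; split; first exact: is_derive_aux.
have := @is_derive_aux R 1 z isT z0 => h.
by deriv; rewrite -(aux_ode z0); ring.
Qed.

Lemma is_lommelS_aux : is_lommelS (- 2^-1) 2^-1 (fun z : R => (root z)^-1 * aux 0 z).
Proof.
set w := fun z : R => _.
pose w1 (z : R) := - (2 * root z * z)^-1 * aux 0 z - (root z)^-1 * aux 1 z.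
have d0 (z : R) : 0 < z -> is_derive z 1 (aux 0) (- aux 1 z) by exact: is_derive_aux.
have d1 (z : R) : 0 < z -> is_derive z 1 (aux 1) (- aux 2 z).
  by move=> z0; exact: is_derive_aux.
have dw (z : R) : 0 < z -> is_derive z 1 w (w1 z).
  move=> z0; have H := d0 z z0; have s0 : 0 < root z by rewrite sqrtr_gt0.
  have zE : z = root z ^+ 2 by rewrite sqr_sqrtr// ltW.
  rewrite /w; deriv; [by rewrite gt_eqF|exact: z0|].
  rewrite /w1; move: (aux 0 z) (aux 1 z) => p q; move: s0 zE; move: (root z) => s s0 ->.
  by field; rewrite gt_eqF.
pose w2 (z : R) := (root z)^-1 * (aux 2 z + aux 1 z / z + 3 / 4 * aux 0 z / z ^+ 2).
have dw1 (z : R) : 0 < z -> is_derive z 1 w1 (w2 z).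
  move=> z0; have H := d0 z z0; have H1 := d1 z z0.
  have s0 : 0 < root z by rewrite sqrtr_gt0.
  have zE : z = root z ^+ 2 by rewrite sqr_sqrtr// ltW.
  rewrite /w1; deriv; [by rewrite !mulf_neq0 ?gt_eqF|exact: z0|
    by rewrite gt_eqF|exact: z0|].
  rewrite /w2; move: (aux 0 z) (aux 1 z) (aux 2 z) => p q r.
  move: s0 zE; move: (root z) => s s0 ->.
  by field; rewrite gt_eqF.
have near_gt0 (z : R) : 0 < z -> \forall y \near z, 0 < y.
  by move=> z0; exact: lt_nbhsr.
have w1E (z : R) : 0 < z -> derive1 w z = w1 z.
  by move=> z0; rewrite derive1E; have [_] := dw z z0.
have dw1' (z : R) : 0 < z -> is_derive z 1 (derive1 w) (w2 z).
  move=> z0; apply: near_eq_is_derive (dw1 z z0).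
  by near=> y; apply/esym/w1E; near: y; exact: near_gt0.
split.
- by move=> z z0; have [] := dw z z0.
- by move=> z z0; have [] := dw1' z z0.
- move=> z z0; rewrite [derive1 (derive1 w) z]derive1E.
  have [_ ->] := dw1' z z0; rewrite w1E//.
  have s0 : 0 < root z by rewrite sqrtr_gt0.
  have zE : z = root z ^+ 2 by rewrite sqr_sqrtr// ltW.
  rewrite (_ : - 2^-1 + 1 = 2^-1); last by lra.
  rewrite powR12_sqrt ?(ltW z0)// /w /w1 /w2.
  have -> : aux 2 z = z^-1 - aux 0 z by rewrite -(aux_ode z0); ring.
  move: (aux 0 z) (aux 1 z) => p q; move: s0 zE; move: (root z) => s s0 ->.
  by field; rewrite gt_eqF.
- move: (@aux0_asymptotics R); apply: cvg_trans; apply: near_eq_cvg; near=> z.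
  have z0 : 0 < z by near: z; apply: nbhs_pinfty_gt; exact: num_real.
  have s0 : 0 < root z by rewrite sqrtr_gt0.
  have -> : - 2^-1 - 1 = - (2^-1 + 1) :> R by lra.
  rewrite powRN invrK powRD ?(gt_eqF z0) ?implybT// powR12_sqrt ?(ltW z0)//.
  rewrite powRr1 ?(ltW z0)// /w.
  by field; rewrite gt_eqF.
Unshelve. all: end_near. Qed.

Lemma sqrt_lommelS (z : R) : 0 < z ->
  Num.sqrt z * lommelS (- 2^-1) 2^-1 z = aux 0 z.
Proof.
have [ow cw] := lommelS_oscillator (xgetPex (fun=> 0) (ex_intro _ _ is_lommelS_aux)).
exact: (oscillator_unique ow aux_oscillator cw (@aux0_asymptotics R)).
Qed.

Lemma lommel_kernelE (z : R) : 0 < z -> lommel_kernel z = explicit_kernel z.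
Proof. by move=> z0; rewrite /lommel_kernel -mulrA sqrt_lommelS. Qed.

End Lommel.

(** * Passage to the mean square limit *)

Section Uniqueness.
Context {R : realType}.
Local Open Scope classical_set_scope.
Local Notation mu := (@lebesgue_measure R).
Implicit Types (f g : R -> R) (N : nat).

Definition window N : set R := `[N%:R^-1, N%:R].

Definition cutoff f N (t : R) : R := if `|f t| <= N%:R then f t else 0.

Lemma measurable_cutoff f N : measurable_fun setT f -> measurable_fun setT (cutoff f N).
Proof.
move=> mf; apply: measurable_fun_ifT => //.
by apply: measurable_fun_ler => //; exact: measurableT_comp.
Qed.

Lemma cutoff_le f N (t : R) : `|cutoff f N t| <= N%:R.
Proof. by rewrite /cutoff; case: ifPn => // _; rewrite normr0. Qed.

(** This identity, which a truncation by [min] and [max] would not satisfy, is the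
    condition of [transform_energy_ge]. *)
Lemma cutoff_mul f N (t : R) : f t * cutoff f N t = cutoff f N t ^+ 2.
Proof. by rewrite /cutoff; case: ifPn => // _; rewrite mulr0 expr0n. Qed.

Lemma cutoff_sqr_le f N (t : R) : cutoff f N t ^+ 2 <= f t ^+ 2.
Proof. by rewrite /cutoff; case: ifPn => // _; rewrite expr0n sqr_ge0. Qed.

Lemma window_Rp N : (0 < N)%N -> window N `<=` Rp.
Proof.
move=> N0 t; rewrite /window RpE /= in_itv/= => /andP[Nt _].
by apply: lt_le_trans Nt; rewrite invr_gt0 ltr0n.
Qed.

Lemma cvg_cutoff f : measurable_fun setT f ->
  mu.-integrable Rp (EFin \o (fun x => f x ^+ 2)) ->
  \int[mu]_(t in window N) cutoff f N t ^+ 2 @[N --> \oo] -->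
  \int[mu]_(t in Rp) f t ^+ 2.
Proof.
move=> mf if2.
have mW N : measurable (window N) by exact: measurable_itv.
have mc N : measurable_fun setT (fun t => cutoff f N t ^+ 2).
  by apply: measurable_funX; exact: measurable_cutoff.
have : \int[mu]_(t in Rp) ((fun t => cutoff f N t ^+ 2) \_ (window N)) t @[N --> \oo] -->
    \int[mu]_(t in Rp) f t ^+ 2.
  apply: (Rintegral_dominated_cvg (g := fun t => f t ^+ 2)) => //.
  - move=> N; apply: measurable_funTS; apply/(measurable_restrictT _ _).1 => //.
    exact: measurable_funTS.
  - exact: measurable_funTS (measurable_funX _ mf).
  - move=> N t _; rewrite patchE; case: ifPn => _; last by rewrite normr0 sqr_ge0.
    by rewrite ger0_norm ?sqr_ge0// cutoff_sqr_le.
  - apply: aeW => t; rewrite RpE => t0; apply: cvg_near_cst; near=> N.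
    have N1 : t^-1 <= N%:R by near: N; exact: nbhs_infty_ger.
    have N2 : t <= N%:R by near: N; exact: nbhs_infty_ger.
    have N3 : `|f t| <= N%:R by near: N; exact: nbhs_infty_ger.
    rewrite patchE /cutoff N3 mem_set// /window /= in_itv/= N2 andbT.
    by rewrite invf_ple ?posrE// (lt_le_trans _ N1) ?invr_gt0.
apply: cvg_trans; apply: near_eq_cvg; near=> N.
rewrite -Rintegral_mkcondr; congr (Rintegral _ _ _); rewrite setIidr//.
by apply: window_Rp; near: N; exact: nbhs_infty_gt.
Unshelve. all: end_near. Qed.

Lemma integrable_window f N : measurable_fun setT f ->
  mu.-integrable Rp (EFin \o (fun x => f x ^+ 2)) -> (0 < N)%N ->
  mu.-integrable (window N) (EFin \o f).
Proof.
move=> mf if2 N0; have mW : measurable (window N) by exact: measurable_itv.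
apply: (@integrable_le_norm R _ _ (fun t => 1 + f t ^+ 2)) => //.
- exact: measurable_funTS.
- move=> t _; rewrite -(real_normK (num_real (f t))).
  have := sqr_ge0 (`|f t| - 1); have := sqr_ge0 (`|f t|); nra.
- apply: (@integrable_add R (window N) (fun=> 1)) => //.
    apply: continuous_compact_integrable; first exact: segment_compact.
    by apply: continuous_subspaceT => t; exact: cvg_cst.
  exact: (integrable_subset measurable_Rp mW (window_Rp N0) if2).
Qed.

Lemma sqr_le_split (d x y : R) : 0 < d ->
  x ^+ 2 <= (1 + d) * y ^+ 2 + (1 + d^-1) * (x - y) ^+ 2.
Proof.
move=> d0; rewrite -subr_ge0.
have -> : (1 + d) * y ^+ 2 + (1 + d^-1) * (x - y) ^+ 2 - x ^+ 2 =
    d * (y - d^-1 * (x - y)) ^+ 2 by field; rewrite gt_eqF.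
by rewrite mulr_ge0 ?sqr_ge0// ltW.
Qed.

Lemma integral_sqr_le_split (d : R) (h g : R -> R) : 0 < d ->
  measurable_fun setT h -> measurable_fun setT g ->
  (\int[mu]_(x in Rp) (h x ^+ 2)%:E <=
   (1 + d)%:E * \int[mu]_(x in Rp) (g x ^+ 2)%:E +
   (1 + d^-1)%:E * \int[mu]_(x in Rp) ((h x - g x) ^+ 2)%:E)%E.
Proof.
move=> d0 mh mg; have d1 : 0 < d^-1 by rewrite invr_gt0.
have m2 (k : R -> R) : measurable_fun setT k -> measurable_fun Rp (fun x => (k x ^+ 2)%:E).
  by move=> mk; apply/measurable_EFinP; apply: measurable_funTS; exact: measurable_funX.
have mg2 := m2 _ mg; have mh2 := m2 _ mh; have mb2 := m2 _ (measurable_funB mh mg).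
rewrite -!ge0_integralZl ?lee_fin ?addr_ge0 ?(ltW d0) ?(ltW d1)//;
  try by move=> x _; rewrite lee_fin sqr_ge0.
rewrite -ge0_integralD//; try by move=> x _; rewrite -EFinM lee_fin mulr_ge0 ?sqr_ge0 ?addr_ge0 ?(ltW d0) ?(ltW d1).
- apply: ge0_le_integral => //.
  + by move=> x _; rewrite lee_fin sqr_ge0.
  + by apply: emeasurable_funD; exact: measurable_funeM.
  + by move=> x _; rewrite -!EFinM -EFinD lee_fin sqr_le_split.
- exact: measurable_funeM.
- exact: measurable_funeM.
Qed.

(** With [d = 1 - c] the constant [1 + d] of [sqr_le_split] satisfies
    [(1 + d) * c = 1 - (1 - c) ^+ 2 < 1]. *)
Lemma contraction (c X : R) : 0 <= c -> c < 1 -> 0 <= X -> X <= (1 + (1 - c)) * (c * X) -> X = 0.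
Proof.
move=> c0 c1 X0 h; apply/eqP; rewrite eq_le X0 andbT.
have : (1 - c) ^+ 2 * X <= 0 by rewrite -subr_ge0 in h; lra.
by rewrite pmulr_rle0// exprn_gt0// subr_gt0.
Qed.

Lemma half_cancel (p y : R) : 0 < p -> y = p / 2 * (2 / p * y).
Proof. by move=> p0; field; rewrite gt_eqF. Qed.

(** The energies [X] of [f] and [Y] of the limit [g] satisfy
    [pi * X <= (1 + d) * Y] for every [d > 0], by [transform_energy_ge] on the
    windows, while the equation gives [Y = pi * (lam ^+ 2 / 2) * X]. *)
Lemma ae_eq0_of_limit (lam : R) f g : lam ^+ 2 < 2 ->
  measurable_fun setT f -> mu.-integrable Rp (EFin \o (fun x => f x ^+ 2)) ->
  measurable_fun setT g -> mu.-integrable Rp (EFin \o (fun x => g x ^+ 2)) ->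
  (forall e : R, 0 < e -> \forall N \near \oo,
    (\int[mu]_(x in Rp) ((transform (window N) (mul_kernel (@explicit_kernel R)) f x - g x) ^+ 2)%:E
      <= e%:E)%E) ->
  {ae mu, forall x, Rp x -> lam * f x + Num.sqrt (2 / pi) * g x = 0} ->
  {ae mu, forall x, Rp x -> f x = 0}.
Proof.
move=> lam2 mf if2 mg ig2 lim eqn; have pi0 := @pi_gt0 R.
pose X := \int[mu]_(x in Rp) f x ^+ 2; pose Y := \int[mu]_(x in Rp) g x ^+ 2.
have X0 : 0 <= X by apply: Rintegral_ge0 => x _; exact: sqr_ge0.
have YX : Y = pi * (lam ^+ 2 / 2 * X).
  rewrite /X mulrA -(RintegralZl (mu := mu) _ measurable_Rp if2) /Y /Rintegral.
  congr fine; apply: ae_eq_integral => //.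
  - by apply/measurable_EFinP; apply: measurable_funTS; exact: measurable_funX.
  - apply/measurable_EFinP; apply: measurable_funTS.
    by apply: measurable_funM => //; exact: measurable_funX.
  - apply: ae_imply eqn => x h xRp; congr EFin.
    have := h xRp; set s := Num.sqrt _ => hs.
    have s2 : s ^+ 2 = 2 / pi by rewrite sqr_sqrtr// divr_ge0// ltW.
    have hh : lam ^+ 2 * f x ^+ 2 = 2 / pi * g x ^+ 2.
      by rewrite -s2 -!exprMn -(addr0_eq hs) sqrrN.
    have -> : pi * (lam ^+ 2 / 2) * f x ^+ 2 = pi / 2 * (lam ^+ 2 * f x ^+ 2) by ring.
    by rewrite hh; exact: half_cancel.
have c1 : lam ^+ 2 / 2 < 1 by rewrite ltr_pdivrMr// mul1r.
set c := lam ^+ 2 / 2 in YX c1.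
have c0 : 0 <= c by rewrite divr_ge0// sqr_ge0.
have bound (e : R) : 0 < e -> pi * X <= (1 + (1 - c)) * Y + (1 + (1 - c)^-1) * e.
  move=> e0.
  have cX : pi * \int[mu]_(t in window N) cutoff f N t ^+ 2 @[N --> \oo] --> pi * X.
    by apply: cvgMl_tmp; exact: cvg_cutoff.
  apply: (cvgr_to_le cX); near=> N.
  have N1 : (1 < N)%N by near: N; exact: nbhs_infty_gt.
  have N0 : (0 < N)%N by exact: ltnW.
  have NR : N%:R^-1 < N%:R :> R.
    rewrite (@lt_trans _ _ 1) ?ltr1n// invf_lt1 ?ltr0n// ltr1n //.
  have mT : measurable_fun setT (transform (window N) (mul_kernel (@explicit_kernel R)) f).
    apply: measurable_transform => //; first exact: measurable_itv.
    by apply: measurable_mul_kernel; exact: measurable_explicit_kernel.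
  have := @transform_energy_ge R N%:R^-1 N%:R _ NR f (cutoff f N) N%:R mf.
  rewrite invr_gt0 ltr0n => /(_ N0 (integrable_window mf if2 N0)
    (measurable_cutoff _ mf) (@cutoff_le f N) (@cutoff_mul f N)) h.
  rewrite -lee_fin; apply: (le_trans h).
  have d0 : 0 < 1 - c by rewrite subr_gt0.
  apply: (le_trans (integral_sqr_le_split d0 mT mg)).
  rewrite [leRHS]EFinD !EFinM; apply: leeD.
    by rewrite /Y /Rintegral fineK//; exact: integrable_fin_num.
  apply: lee_wpmul2l; first by rewrite lee_fin addr_ge0// invr_ge0 ltW.
  by near: N; exact: lim.
have XY : pi * X <= (1 + (1 - c)) * Y.
  apply/ler_addgt0Pr => e e0.
  have d0 : 0 < 1 + (1 - c)^-1 by rewrite ltr_wpDr// invr_ge0 subr_ge0 ltW.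
  by have := bound _ (divr_gt0 e0 d0); rewrite mulrCA divff ?gt_eqF// mulr1.
have XE : X = 0.
  apply: (contraction c0 c1 X0).
  by rewrite -(ler_pM2l pi0) mulrCA -YX.
have : (\int[mu]_(x in Rp) `|(f x ^+ 2)%:E| = 0)%E.
  transitivity (X%:E)%E; last by rewrite XE.
  rewrite /X /Rintegral fineK; last exact: integrable_fin_num.
  by apply: eq_integral => x _; rewrite gee0_abs// lee_fin sqr_ge0.
move/ae_eq_integral_abs => H.
have {}H := H measurable_Rp (measurable_int mu if2).
apply: ae_imply H => x h xRp; have := h xRp; rewrite /cst => -[/eqP].
by rewrite sqrf_eq0 => /eqP.
Unshelve. all: end_near. Qed.

End Uniqueness.

(** * Real and imaginary parts *)

Section ComplexParts.
Context {R : realType}.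
Local Open Scope classical_set_scope.
Local Open Scope complex_scope.
Local Notation mu := (@lebesgue_measure R).
Implicit Types (f g h : R -> R[i]) (b : bool).

(** Both parts in one function, so that each argument is written once. *)
Definition part b (z : R[i]) : R := if b then complex.Re z else complex.Im z.

Definition half_part b f : R -> R := (fun x => part b (f x)) \_ (Rplus R).

Lemma half_partE b f (x : R) : 0 < x -> half_part b f x = part b (f x).
Proof. by move=> x0; rewrite /half_part patchE mem_set. Qed.

Lemma RplusE : Rplus R = Rp.
Proof. by apply/seteqP; split => x; rewrite RpE. Qed.

Lemma part0 b : part b 0 = 0.
Proof. by case: b. Qed.

Lemma partD b (z w : R[i]) : part b (z + w) = part b z + part b w.
Proof. by case: b z w => -[? ?] [? ?]. Qed.

Lemma partB b (z w : R[i]) : part b (z - w) = part b z - part b w.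
Proof. by case: b z w => -[? ?] [? ?]. Qed.

Lemma partZ b (r : R) (z : R[i]) : part b (r%:C * z) = r * part b z.
Proof.
by case: b z => -[x y]; rewrite /part/= !mul0r ?subr0 ?addr0.
Qed.

Lemma part_eq0 (z : R[i]) : (forall b, part b z = 0) -> z = 0.
Proof. by case: z => x y h; have /= -> := h true; have /= -> := h false. Qed.

Lemma L2_half_part b f : L2 f ->
  measurable_fun setT (half_part b f) /\
  mu.-integrable Rp (EFin \o (fun x => half_part b f x ^+ 2)).
Proof.
move=> [fRe fIm]; have hb : half_part b f \in Lfun mu 2%:E by case: b.
split; first by move: hb; rewrite inE => /andP[+ _]; rewrite inE.
apply: (integrable_subset measurableT) => //; exact: Lfun2_integrable_sqr.
Qed.

Lemma part_truncated b f N (x : R) : (0 < N)%N -> 0 < x ->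
  part b (truncated_transform f N x) =
  transform (window N) (mul_kernel (@explicit_kernel R)) (half_part b f) x.
Proof.
move=> N0 x0; transitivity (\int[mu]_(t in window N)
    part b ((lommel_kernel (x * t))%:C * f t)); first by case: b.
apply: eq_Rintegral => t; rewrite inE => /(window_Rp N0); rewrite RpE => t0.
by rewrite partZ lommel_kernelE ?mulr_gt0// half_partE.
Qed.

Lemma L2norm_sqr h : (L2norm h `^ 2 =
  \int[mu]_(x in Rp) (part true (h x) ^+ 2 + part false (h x) ^+ 2)%:E)%E.
Proof.
rewrite /L2norm poweR_Lnorm// [RHS]integral_mkcond; apply: eq_integral => x _.
rewrite /= !patchE RplusE; case: ifPn => _; last by rewrite normr0 powR0.
case: (h x) => p q /=; rewrite (powR_mulrn 2)// real_normK ?num_real// sqr_sqrtr//.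
by rewrite addr_ge0 ?sqr_ge0.
Qed.

(** The square of the norm is the sum of the energies of the two parts, hence
    bounds each of them. *)
Lemma limit_half_part b f g : L2 f ->
  mean_square_limit (truncated_transform f) g ->
  forall e : R, 0 < e -> \forall N \near \oo,
    (\int[mu]_(x in Rp) ((transform (window N) (mul_kernel (@explicit_kernel R)) (half_part b f) x
       - half_part b g x) ^+ 2)%:E <= e%:E)%E.
Proof.
move=> f2 [g2 /fine_cvgP[fin lim]] e e0.
have se0 : 0 < Num.sqrt e by rewrite sqrtr_gt0.
have le_se : \forall N \near \oo,
    fine (L2norm (fun x => truncated_transform f N x - g x)) < Num.sqrt e.
  exact: (cvgr_lt _ lim).
near=> N; have N0 : (0 < N)%N by near: N; exact: nbhs_infty_gt.
have n_fin : L2norm (fun x => truncated_transform f N x - g x) \is a fin_num.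
  by near: N; exact: fin.
have n_lt : fine (L2norm (fun x => truncated_transform f N x - g x)) < Num.sqrt e.
  by near: N; exact: le_se.
set n := L2norm _ in n_fin n_lt.
have n0 : 0 <= fine n by rewrite fine_ge0// Lnorm_ge0.
have mW : measurable (window N : set R) by exact: measurable_itv.
have m c : measurable_fun setT (fun x => transform (window N) (mul_kernel (@explicit_kernel R))
    (half_part c f) x - half_part c g x).
  apply: measurable_funB; last by have [] := L2_half_part c g2.
  apply: measurable_transform => //.
    by apply: measurable_mul_kernel; exact: measurable_explicit_kernel.
  by have [] := L2_half_part c f2.
apply: (@le_trans _ _ (n `^ 2)%E); last first.
  rewrite -(fineK n_fin) poweR_EFin lee_fin (powR_mulrn 2)//.
  by rewrite -[leRHS](sqr_sqrtr (ltW e0)) ler_sqr ?nnegrE ?sqrtr_ge0// ltW.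
rewrite L2norm_sqr.
have -> : (\int[mu]_(x in Rp) (part true (truncated_transform f N x - g x) ^+ 2 +
     part false (truncated_transform f N x - g x) ^+ 2)%:E =
   \int[mu]_(x in Rp) ((transform (window N) (mul_kernel (@explicit_kernel R)) (half_part true f) x
       - half_part true g x) ^+ 2 + (transform (window N) (mul_kernel (@explicit_kernel R))
       (half_part false f) x - half_part false g x) ^+ 2)%:E)%E.
  apply: eq_integral => x; rewrite inE RpE => x0.
  by rewrite !partB !part_truncated// !half_partE.
apply: ge0_le_integral => //.
- by move=> x _; rewrite lee_fin sqr_ge0.
- apply/measurable_EFinP; apply: measurable_funTS.
  exact: (measurable_funX _ (m b)).
- apply/measurable_EFinP; apply: measurable_funTS.
  exact: (measurable_funD (measurable_funX 2 (m true)) (measurable_funX 2 (m false))).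
- by move=> x _; rewrite lee_fin; case: b; rewrite ?lerDl ?lerDr sqr_ge0.
Unshelve. all: end_near. Qed.

Lemma ae_eq0_of_equation (lam : R) f : lam ^+ 2 < 2 -> L2 f ->
  solves_equation lam f -> {ae mu, forall x : R, 0 < x -> f x = 0}.
Proof.
move=> lam2 f2 [g [lim eqn]]; have [g2 _] := lim.
have H b : {ae mu, forall x : R, Rp x -> half_part b f x = 0}.
  have [mf if2] := L2_half_part b f2; have [mg ig2] := L2_half_part b g2.
  apply: (ae_eq0_of_limit lam2 mf if2 mg ig2); first exact: limit_half_part.
  apply: ae_imply eqn => x h; rewrite RpE => x0.
  rewrite !half_partE// -!partZ -partD h//; exact: part0.
apply: ae_imply2 (H true) (H false) => x h1 h2 x0; apply: part_eq0 => b.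
have xRp : Rp x by rewrite RpE.
by rewrite -half_partE//; case: b; [exact: h1|exact: h2].
Qed.

Lemma truncated_transform_ae0 f N (x : R) : L2 f ->
  {ae mu, forall x : R, 0 < x -> f x = 0} -> (0 < N)%N -> 0 < x ->
  truncated_transform f N x = 0.
Proof.
move=> f2 f0 N0 x0; apply: part_eq0 => b; rewrite part_truncated//.
have [mf _] := L2_half_part b f2.
have mW : measurable (window N : set R) by exact: measurable_itv.
rewrite /transform /Rintegral -[RHS]/(fine 0%E); congr fine.
rewrite -(integral0 mu (window N)); apply: ae_eq_integral => //.
- apply/measurable_EFinP; apply: measurable_funTS; apply: measurable_funM => //.
  by apply: measurable_section; apply: measurable_mul_kernel; exact: measurable_explicit_kernel.
- apply: ae_imply f0 => t h /(window_Rp N0); rewrite RpE => t0.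
  by rewrite half_partE// h// part0 mulr0.
Qed.

Lemma equation_of_ae_eq0 (lam : R) f : L2 f ->
  {ae mu, forall x : R, 0 < x -> f x = 0} -> solves_equation lam f.
Proof.
move=> f2 f0; exists (fun=> 0); split; last first.
  by apply: ae_imply f0 => x h x0; rewrite h// !mulr0 addr0.
split.
  have : (cst 0 : R -> R) \in Lfun mu 2%:E.
    by rewrite inE; apply/andP; split; rewrite inE//= /finite_norm Lnorm0.
  have -> : cst 0 = (fun x : R => complex.Re (0 : R[i])) \_ (Rplus R) :> (R -> R).
    by apply/funext => x; rewrite patchE; case: ifP.
  by [].
apply: cvg_near_cst; near=> N.
have N0 : (0 < N)%N by near: N; exact: nbhs_infty_gt.
rewrite /L2norm (_ : EFin \o _ = cst 0%E); first by rewrite Lnorm0.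
apply/funext => x; rewrite /comp patchE; case: ifPn => //; rewrite inE => x0.
by rewrite truncated_transform_ae0// subr0 normr0.
Unshelve. all: end_near. Qed.

End ComplexParts.

Local Open Scope complex_scope.

Theorem corollary5 (R : realType) (lam : R)
    (hlam : - Num.sqrt 2 < lam < Num.sqrt 2) (f : R -> R[i]) (hf : L2 f) :
  solves_equation lam f <->
  {ae @lebesgue_measure R, forall x : R, 0 < x -> f x = 0}.
Proof.
split; last exact: equation_of_ae_eq0.
apply: ae_eq0_of_equation => //.
rewrite -(real_normK (num_real lam)) -[ltRHS](@sqr_sqrtr R 2)//.
by rewrite ltr_sqr ?nnegrE ?sqrtr_ge0// ltr_norml.
Qed.
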